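(* Let $g:[0,1]^2\to[0,1]$ be a function satisfying the following five conditions: (1) $g$ is continuous; (2) $g(x,y)$ is non-decreasing in $x$ and non-increasing in $y$; (3) $\frac{\partial g(x,y)}{\partial x}\le g(x,y)$; (4) $\frac{\partial g(x,y)}{\partial y}\ge g(x,y)-1$; (5) for all $x,y,y'\in[0,1]$ with $y'>y$, $g(1,y)-g(x,y)\ge g(1,y')-g(x,y')$. Then, for the maximum vertex-weighted online bipartite matching problem in the random arrival model, the generalized RANKING algorithm using $g$ has competitive ratio at least $$\min_{0\le\gamma,\tau\le1}\Big\{(1-\tau)(1-\gamma)+(1-\tau)\int_0^\gamma g(x,\tau)\,dx+\int_0^\tau\min_{0\le\theta\le\gamma}\Big\{(1-g(\theta,y))+\int_0^\theta g(x,y)\,dx+\int_\theta^\gamma g(x,\tau)\,dx\Big\}dy\Big\}.$$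
   Context: Problem: a bipartite graph $G=(U,V,E)$ with offline vertices $V$, each $v\in V$ having weight $w_v\ge0$, and online vertices $U$. The goal is a matching maximizing the total weight of matched vertices of $V$. Online vertices arrive in uniformly random order; when $u$ arrives its incident edges are revealed and the algorithm must irrevocably match $u$ to a currently unmatched neighbour or leave it unmatched. Generalized RANKING with function $g$: each offline $v\in V$ draws $y_v\in[0,1]$ uniformly at random, and each online $u\in U$ draws $y_u\in[0,1]$ uniformly at random, all independently; online vertices arrive in nondecreasing order of $y_u$ (this realizes the uniformly random arrival order). When $u$ arrives it is matched to the unmatched neighbour $v$ (if any) maximizing $w_v(1-g(y_v,y_u))$. The competitive ratio is at least $\beta$ means that for every instance, the expected total weight of the matching produced is at least $\beta$ times the maximum weight of a matching in $G$. The partial-derivative conditions (3),(4) are to be understood, for non-differentiable $g$ (e.g. piecewise-affine $g$), in terms of one-sided derivatives/subgradients. *)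

(* Defs.v *)
From HB Require Import structures.
From mathcomp Require Import all_boot all_order all_algebra.
From mathcomp Require Import all_classical all_reals all_analysis.

Set Implicit Arguments.
Unset Strict Implicit.
Unset Printing Implicit Defensive.

Import Order.TTheory GRing.Theory Num.Theory.
Import numFieldNormedType.Exports.

Local Open Scope classical_set_scope.
Local Open Scope ring_scope.

(** Dini derivatives. A one-sided derivative, where it exists, equals both the
    upper and the lower Dini derivative on that side; unlike one-sided
    derivatives, Dini derivatives always exist in [\bar R]. *)

Section Dini.
Variable R : realType.
Implicit Types (f : R -> R) (x : R).

Definition diff_quot f x (h : R) : \bar R := ((f (x + h) - f x) / h)%:E.

Definition upper_dini_right f x := limf_esup (diff_quot f x) 0^'+.
Definition upper_dini_left f x := limf_esup (diff_quot f x) 0^'-.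
Definition lower_dini_right f x := limf_einf (diff_quot f x) 0^'+.
Definition lower_dini_left f x := limf_einf (diff_quot f x) 0^'-.

(* At the end points of [0, 1] only the side inside the interval is used, so
   the values of [f] outside [0, 1] are irrelevant. *)
Definition deriv_le01 f (b : R -> R) : Prop :=
  (forall x, 0 <= x < 1 -> (upper_dini_right f x <= (b x)%:E)%E) /\
  (forall x, 0 < x <= 1 -> (upper_dini_left f x <= (b x)%:E)%E).

Definition deriv_ge01 f (b : R -> R) : Prop :=
  (forall x, 0 <= x < 1 -> ((b x)%:E <= lower_dini_right f x)%E) /\
  (forall x, 0 < x <= 1 -> ((b x)%:E <= lower_dini_left f x)%E).

End Dini.

(** [U] is the online side and [V] the (weighted) offline side. *)

Section Matching.
Variables (R : realType) (U V : finType) (E : U -> V -> bool) (w : V -> R).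
Implicit Type M : {set U * V}.

Definition is_matching M : bool :=
  [forall e in M, E e.1 e.2] &&
  [forall e in M, forall e' in M,
     ((e.1 == e'.1) || (e.2 == e'.2)) ==> (e == e')].

Definition matched_offline M : {set V} := [set e.2 | e in M]%SET.

Definition matching_weight M : R := \sum_(v in matched_offline M) w v.

(* The default value 0 is the weight of the empty matching. *)
Definition max_matching_weight : R :=
  \big[Num.max/0]_(M : {set U * V} | is_matching M) matching_weight M.

End Matching.

(** [y (inr v)] is the rank of the offline vertex [v] and
    [y (inl u)] the arrival time of the online vertex [u]. Ties between offline
    vertices, which may occur with positive probability (e.g. when [g] is
    constant), are broken by the fixed vertex identities [idV]; simultaneous
    arrivals are ordered by the enumeration of [U]. *)

Section Ranking.
Variables (R : realType) (g : R -> R -> R).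
Variables (U V : finType) (E : U -> V -> bool) (w : V -> R) (idV : V -> nat).
Variable y : U + V -> R.

Definition score (u : U) (v : V) : R := w v * (1 - g (y (inr v)) (y (inl u))).

Definition preferred (u : U) (v v' : V) : bool :=
  (score u v' < score u v) ||
  ((score u v' == score u v) && (idV v <= idV v')%N).

Definition available (M : {set U * V}) (u : U) : {set V} :=
  [set v | E u v & v \notin matched_offline M]%SET.

Definition ranking_step (M : {set U * V}) (u : U) : {set U * V} :=
  if [pick v in available M u | [forall v' in available M u, preferred u v v']]
    is Some v then (u, v) |: M else M.

Definition arrival_order : seq U :=
  sort (fun u u' => y (inl u) <= y (inl u')) (enum U).

Definition ranking_matching : {set U * V} :=
  foldl ranking_step finset.set0 arrival_order.

End Ranking.

Section IidUniform.
Context d (T : measurableType d) (R : realType) (P : probability T R).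
Variables (I : finType) (Y : I -> {RV P >-> R}).

Definition mutually_independent : Prop :=
  forall (J : {set I}) (B : I -> set R), (forall i, measurable (B i)) ->
    P (\bigcap_(i in [set` J]) (Y i @^-1` B i)) =
    (\prod_(i in J) P (Y i @^-1` B i))%E.

Definition iid_uniform01 : Prop :=
  [/\ forall i t, 0 <= Y i t <= 1,
      forall i (A : set R), measurable A ->
        distribution P (Y i) A = uniform_prob (@ltr01 R) A
    & mutually_independent].

End IidUniform.

(* The expectation depends only on the joint law of the draws, so the
   quantification is over all probability spaces carrying such draws. *)
Definition ranking_competitive_ratio_ge (R : realType) (g : R -> R -> R)
    (beta : R) : Prop :=
  forall (U V : finType) (E : U -> V -> bool) (w : V -> R) (idV : V -> nat),
    (forall v, 0 <= w v) -> injective idV ->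
  forall (d : measure_display) (T : measurableType d) (P : probability T R)
    (Y : U + V -> {RV P >-> R}),
    iid_uniform01 Y ->
  ((beta * max_matching_weight E w)%:E <=
   'E_P[fun t => matching_weight w (ranking_matching g E w idV (Y ^~ t))])%E.

(** The minima range over nonempty compact sets of parameters
    and, for continuous [g] with values in [0, 1], are attained by continuous
    nonnegative functions, so they are the values of [inf]. *)

Section Bound.
Variables (R : realType) (g : R -> R -> R).
Let mu := @lebesgue_measure R.

Definition inner_objective (gamma tau y theta : R) : R :=
  (1 - g theta y) + (\int[mu]_(x in `[0, theta]) g x y)
  + (\int[mu]_(x in `[theta, gamma]) g x tau).

Definition inner_min (gamma tau y : R) : R :=
  inf [set inner_objective gamma tau y theta | theta in `[0, gamma]].

Definition outer_objective (gamma tau : R) : R :=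
  (1 - tau) * (1 - gamma)
  + (1 - tau) * (\int[mu]_(x in `[0, gamma]) g x tau)
  + \int[mu]_(y in `[0, tau]) inner_min gamma tau y.

Definition ranking_bound : R :=
  inf [set outer_objective p.1 p.2 | p in `[0, 1] `*` `[0, 1]].

End Bound.

(* Main.v *)
Require Import Defs.
From HB Require Import structures.
From mathcomp Require Import all_boot all_order all_algebra.
From mathcomp Require Import all_classical all_reals all_analysis.
From mathcomp Require Import measurable_realfun ring lra.

Import Order.TTheory GRing.Theory Num.Theory.
Import numFieldNormedType.Exports.

Set Implicit Arguments.
Unset Strict Implicit.
Unset Printing Implicit Defensive.

Local Open Scope classical_set_scope.
Local Open Scope ring_scope.

(** When [u] is matched to [v], split the weight [w v] into an online gain [w v * (1 - g y_v y_u)]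
    and an offline gain [w v * g y_v y_u]. It suffices to show that for each edge [(u, v)] of an
    optimal matching the two gains add up to at least [w v] times the bound in expectation, and
    this already holds after fixing all draws but [x = y_v] and [b = y_u].

    Let [t x] be the time at which [v] is matched when [u] is absent, and call [x] displaced at time
    [b] if [v] is then still free and some free neighbour of [u] is worth at least as much as [v].
    With weights normalised by [w v], the offline gain is at least [g x (t x)], and at least [g x b]
    if [x] is not displaced; if [x0] is displaced at [b], the online gain is at least [1 - g x0 b]
    whatever [x] is; and if [x] is not displaced and [b < t x], then [u] takes [v] and the gains add
    up to 1. By (5), displacement of [x = 1] persists to earlier times. So let [gamma] be the
    supremum of the [x] with [t x <= 1], and [tau] the first time after which [x = 1] is not
    displaced. Times [b < tau] yield the integrand of the bound with [theta] the displacement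
    threshold, (3) taking care of thresholds beyond [gamma]; times [b > tau] yield the other two
    terms. If [t x > tau], the early times fall short by at most [g x tau - g x (t x)] each, which
    by (4) the surplus of the late times makes up for. *)

(** * Greedy matching in a given order *)

Section Greedy.
Variables (U V : finType) (E : U -> V -> bool).
Implicit Types (pr : U -> rel V) (A B : {set V}) (s : seq U) (u : U) (v : V).

Definition linear_prefs pr :=
  forall u, [/\ total (pr u), transitive (pr u) & antisymmetric (pr u)].

Definition best pr A u v : bool :=
  [&& v \in A, E u v & [forall v' in A, E u v' ==> pr u v v']].

Definition choice pr A u : option V := [pick v | best pr A u v].

Definition step pr A u : {set V} := if choice pr A u is Some v then A :\ v else A.

Definition run pr A s : {set V} := foldl (step pr) A s.

Lemma bestP pr A u v :
  reflect [/\ v \in A, E u v & forall v', v' \in A -> E u v' -> pr u v v']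
          (best pr A u v).
Proof.
apply: (iffP and3P) => -[-> -> h]; split=> //.
  by move=> v' v'A; exact/implyP/(forall_inP h).
by apply/forall_inP => v' v'A; apply/implyP; exact: h.
Qed.

Lemma choice_best pr A u v : choice pr A u = Some v -> best pr A u v.
Proof. by rewrite /choice; case: pickP => // x bx [<-]. Qed.

Lemma best_choice pr A u v :
  linear_prefs pr -> best pr A u v -> choice pr A u = Some v.
Proof.
move=> /(_ u)[_ _ anti] bv; rewrite /choice; case: pickP => [x bx|/(_ v)]; last by rewrite bv.
congr Some; move/bestP: bx => [xA Ex hx]; move/bestP: bv => [vA Ev hv].
by apply: anti; rewrite hx// hv.
Qed.

Lemma choice_exists pr A u v : linear_prefs pr -> v \in A -> E u v ->
  exists2 v', choice pr A u = Some v' & pr u v' v.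
Proof.
move=> lpr vA Ev; have [tot tr _] := lpr u.
have refl : reflexive (pr u) by move=> x; have := tot x x; rewrite orbb.
case: (@extremumP V V (pr u) v [pred x | (x \in A) && E u x] id refl tr tot).
  by rewrite /= vA.
move=> x /andP[xA Ex] hx; exists x; last by apply: hx; rewrite /= vA.
apply: best_choice => //; apply/bestP; split=> // v' v'A Ev'.
by apply: hx; rewrite /= v'A.
Qed.

Lemma best_sub pr A B u v :
  A \subset B -> v \in A -> best pr B u v -> best pr A u v.
Proof.
move=> /fintype.subsetP AB vA /bestP[_ Ev h]; apply/bestP; split=> // v' v'A.
by apply: h; exact: AB.
Qed.

Lemma step_subset pr A u : step pr A u \subset A.
Proof. by rewrite /step; case: choice => // v; rewrite subD1set. Qed.

(** The vertex [b] chosen from [B] either lies in [A], where it is again the best and leaves both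
    sets, or it is outside [A], so that removing it from [B] does no harm. *)
Lemma step_mono pr A B u : linear_prefs pr ->
  A \subset B -> step pr A u \subset step pr B u.
Proof.
move=> lpr AB; rewrite {2}/step; case eB : (choice pr B u) => [b|]; last first.
  exact: fintype.subset_trans (step_subset _ _ _) AB.
have [bA|bA] := boolP (b \in A).
  rewrite /step (best_choice lpr (best_sub AB bA (choice_best eB))).
  exact: finset.setSD.
apply: (fintype.subset_trans (step_subset _ _ _)).
by rewrite finset.subsetD1 AB bA.
Qed.

Lemma run_cat pr A s1 s2 : run pr A (s1 ++ s2) = run pr (run pr A s1) s2.
Proof. exact: foldl_cat. Qed.

Lemma run_mono pr A B s : linear_prefs pr ->
  A \subset B -> run pr A s \subset run pr B s.
Proof.
by move=> lpr; elim: s A B => //= u s IHs A B AB; exact/IHs/step_mono.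
Qed.

Lemma run_subset pr A s : run pr A s \subset A.
Proof.
elim: s A => //= u s IHs A; exact: fintype.subset_trans (IHs _) (step_subset _ _ _).
Qed.

(** A vertex outside the free set never returns to it, so comparisons that involve [v] cannot
    influence the run. *)
Lemma run_ext pr pr' A s v : v \notin A ->
  (forall u a b, u \in s -> a != v -> b != v -> pr u a b = pr' u a b) ->
  run pr A s = run pr' A s.
Proof.
elim: s A => //= u s IHs A vA h.
have -> : step pr A u = step pr' A u.
  rewrite /step (_ : choice pr A u = choice pr' A u)//.
  apply: eq_pick => a; rewrite /best; apply: andb_id2l => aA; congr (_ && _).
  apply: eq_forallb => b; have [bA/=|//] := boolP (b \in A); congr (_ ==> _).
  apply: h; rewrite ?mem_head//.
    by apply: contraNneq vA => <-.
  by apply: contraNneq vA => <-.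
apply: IHs => [|x a b xs]; last by apply: h; rewrite inE xs orbT.
by apply: contra vA; exact/fintype.subsetP/step_subset.
Qed.

Lemma run_eq_prefs pr pr' A s :
  (forall u a b, u \in s -> pr u a b = pr' u a b) -> run pr A s = run pr' A s.
Proof.
elim: s A => //= u s IHs A h.
have -> : step pr A u = step pr' A u.
  rewrite /step (_ : choice pr A u = choice pr' A u)//.
  apply: eq_pick => a; rewrite /best; congr [&& _, _ & _].
  by apply: eq_forallb => b; rewrite h ?mem_head.
by apply: IHs => x a b xs; apply: h; rewrite inE xs orbT.
Qed.

Lemma choice_setU1 pr A u v : linear_prefs pr ->
  choice pr (v |: A) u <> Some v -> choice pr (v |: A) u = choice pr A u.
Proof.
move=> lpr; case e : (choice pr (v |: A) u) => [b|].
  have [->//|bv _] := eqVneq b v.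
  apply/esym/(best_choice lpr)/(best_sub _ _ (choice_best e)); first exact: finset.subsetU1.
  by case/bestP: (choice_best e); rewrite !inE (negbTE bv).
move=> _; case e' : (choice pr A u) => [b|//].
have /bestP[bA Eb _] := choice_best e'.
have [||b' ] := @choice_exists pr (v |: A) u b lpr => //.
  by rewrite !inE bA orbT.
by rewrite e.
Qed.

Lemma step_setU1 pr A u v : linear_prefs pr -> v \notin A ->
  v \in step pr (v |: A) u -> step pr (v |: A) u = v |: step pr A u.
Proof.
move=> lpr vA vs.
have nv : choice pr (v |: A) u <> Some v.
  by move=> e; move: vs; rewrite /step e !inE eqxx.
rewrite /step (choice_setU1 lpr nv); case e : (choice pr A u) => [b|//].
have bv : v != b.
  by apply/eqP => vb; apply: (nv); rewrite (choice_setU1 lpr nv) e vb.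
apply/setP => x; rewrite !inE; have [->|] := eqVneq x v; last by rewrite !orFb.
by rewrite bv.
Qed.

(** As long as nobody takes [v], its presence changes no choice: a best vertex other than [v] stays
    best when [v] is removed. *)
Lemma run_setU1 pr A s v : linear_prefs pr -> v \notin A ->
  v \in run pr (v |: A) s -> run pr (v |: A) s = v |: run pr A s.
Proof.
move=> lpr; elim: s A => //= u s IHs A vA vr.
have vs : v \in step pr (v |: A) u.
  by move: vr; exact/fintype.subsetP/run_subset.
move: vr; rewrite (step_setU1 lpr vA vs); apply: IHs.
by apply: contra vA; exact/fintype.subsetP/step_subset.
Qed.

(** Survival of [v] is monotone in its rank. While [v] is free the two runs agree on all other
    vertices, and whoever passes over [v] under [pr] also does so under [pr'], where [v] is ranked
    no better. *)
Lemma run_worse_rank pr pr' A s v :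
  linear_prefs pr -> linear_prefs pr' -> v \notin A ->
  (forall u a b, u \in s -> a != v -> b != v -> pr u a b = pr' u a b) ->
  (forall u a, u \in s -> pr' u v a -> pr u v a) ->
  v \in run pr (v |: A) s -> v \in run pr' (v |: A) s.
Proof.
move=> lpr lpr'; elim: s A => //= u s IHs A vA agree worse vr.
have vs : v \in step pr (v |: A) u.
  by move: vr; exact/fintype.subsetP/run_subset.
have vs' : v \in step pr' (v |: A) u.
  rewrite /step; case e : (choice pr' (v |: A) u) => [b|]; last by rewrite !inE eqxx.
  (* A vertex [v] that is best under [pr'] is also best under [pr], and would have been taken there
     too. *)
  rewrite !inE eqxx /= andbT; apply: contraPneq vs => vb; rewrite -vb in e.
  have /bestP[h1 h2 h3] := choice_best e.
  have : best pr (v |: A) u v.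
    apply/bestP; split => // v' v'A Ev'.
    by apply: worse; rewrite ?mem_head//; exact: h3.
  by move=> /(best_choice lpr); rewrite /step => ->; rewrite !inE eqxx.
rewrite (step_setU1 lpr' vA vs'); move: vr; rewrite (step_setU1 lpr vA vs).
have -> : step pr A u = step pr' A u.
  apply: (@run_ext pr pr' A [:: u] v vA) => x a b; rewrite inE => /eqP->.
  by apply: agree; rewrite mem_head.
apply: IHs.
- by apply: contra vA; exact/fintype.subsetP/step_subset.
- by move=> x a b xs; apply: agree; rewrite inE xs orbT.
- by move=> x a xs; apply: worse; rewrite inE xs orbT.
Qed.

End Greedy.

(** * RANKING as a greedy run on the free offline vertices *)

Section RankingRun.
Variables (R : realType) (g : R -> R -> R).
Variables (U V : finType) (E : U -> V -> bool) (w : V -> R) (idV : V -> nat).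
Hypothesis idV_inj : injective idV.
Variable y : U + V -> R.

Local Notation pr := (preferred g w idV y).
Local Notation free M := (~: matched_offline M)%SET.
Local Notation steps := (foldl (ranking_step g E w idV y)).
Implicit Types (M : {set U * V}) (s : seq U) (u : U) (v : V).

Lemma preferred_linear : linear_prefs pr.
Proof.
move=> u; split.
- by move=> a b; rewrite /preferred; case: ltgtP => //= _; exact: leq_total.
- move=> b a c; rewrite /preferred => /orP[ab|/andP[/eqP ab iab]] /orP[bc|/andP[/eqP bc ibc]].
  + by rewrite (lt_trans bc ab).
  + by rewrite bc ab.
  + by rewrite -ab bc.
  + by rewrite bc ab eqxx (leq_trans iab ibc) orbT.
- move=> a b; rewrite /preferred; case: ltgtP => //= _ h.
  by apply: idV_inj; apply/eqP; rewrite eqn_leq.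
Qed.

Lemma ranking_stepE M u : ranking_step g E w idV y M u =
  if choice E pr (free M) u is Some v then (u, v) |: M else M.
Proof.
rewrite /ranking_step /choice; congr (if _ is Some v then _ else _).
apply: eq_pick => v; rewrite /best /available !inE.
rewrite [in RHS]andbCA -andbA; congr [&& _, _ & _]; apply: eq_forallb => v'.
by rewrite !inE; case: (v' \in matched_offline M); case: (E u v').
Qed.

Lemma matched_offlineU1 M u v :
  matched_offline ((u, v) |: M) = (v |: matched_offline M)%SET.
Proof. by rewrite /matched_offline imsetU1. Qed.

Lemma free_ranking_step M u :
  free (ranking_step g E w idV y M u) = step E pr (free M) u.
Proof.
rewrite ranking_stepE /step; case: choice => // v.
by rewrite matched_offlineU1; apply/setP => x; rewrite !inE negb_or.
Qed.

Lemma free_steps M s : free (steps M s) = run E pr (free M) s.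
Proof. by elim: s M => //= u s IHs M; rewrite IHs free_ranking_step. Qed.

Lemma free0 : free (finset.set0 : {set U * V}) = [set: V]%SET.
Proof. by rewrite /matched_offline imset0 finset.setC0. Qed.

Lemma steps_subset M s : M \subset steps M s.
Proof.
elim: s M => //= u s IHs M; apply: fintype.subset_trans (IHs _).
by rewrite ranking_stepE; case: choice => // v; rewrite finset.subsetU1.
Qed.

Lemma steps_choice s1 s2 u v :
  choice E pr (run E pr [set: V]%SET s1) u = Some v ->
  (u, v) \in steps finset.set0 (s1 ++ u :: s2).
Proof.
rewrite foldl_cat /= -free0 -free_steps => e.
apply/(fintype.subsetP (steps_subset _ _)).
by rewrite ranking_stepE e !inE eqxx.
Qed.

Lemma steps_matched s1 s2 v : v \notin run E pr [set: V]%SET s1 ->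
  exists2 u, u \in s1 & (u, v) \in steps finset.set0 (s1 ++ s2).
Proof.
elim/last_ind: s1 s2 => [|s1 u IHs] s2; first by rewrite inE.
rewrite -cats1 run_cat /= {1}/step.
have [vr|vr _] := boolP (v \in run E pr [set: V]%SET s1); last first.
  have [u' u's h] := IHs (u :: s2) vr.
  by exists u'; rewrite ?mem_cat ?u's// -catA.
case e : choice => [b|]; last by rewrite vr.
rewrite !inE vr andbT negbK => /eqP vb.
exists u; first by rewrite mem_cat mem_head orbT.
by rewrite -catA; apply: steps_choice; rewrite e vb.
Qed.

(** Only free vertices are chosen, so no offline vertex is matched twice. This lets the weight of
    the matching be summed over its edges. *)
Lemma steps_snd_inj M s : {in M &, injective snd} ->
  {in steps M s &, injective (@snd U V)}.
Proof.
elim: s M => //= u s IHs M inj; apply: IHs.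
rewrite ranking_stepE; case e : choice => [v|//].
have /bestP[vf _ _] := choice_best e.
have nv u' : (u', v) \notin M.
  by apply: contraL vf => h; rewrite !inE negbK; apply/imsetP; exists (u', v).
move=> [u1 v1] [u2 v2]; rewrite !inE => /orP[/eqP[-> ->]|h1] /orP[/eqP[-> ->]|h2]//=.
- by move=> vv; move: h2; rewrite -vv (negbTE (nv _)).
- by move=> vv; move: h1; rewrite vv (negbTE (nv _)).
- by move=> vv; exact: (inj _ _ h1 h2).
Qed.

Lemma ranking_snd_inj :
  {in ranking_matching g E w idV y &, injective (@snd U V)}.
Proof. by apply: steps_snd_inj => e; rewrite inE. Qed.

End RankingRun.

(** * Gain sharing along one edge *)

Definition redraw (R : realType) (U V : finType) (z : U + V -> R) (u : U) (v : V)
    (x b : R) : U + V -> R :=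
  fun i => match i with
           | inl u' => if u' == u then b else z (inl u')
           | inr v' => if v' == v then x else z (inr v')
           end.

Section Gains.
Variables (R : realType) (g : R -> R -> R).
Variables (U V : finType) (E : U -> V -> bool) (w : V -> R) (idV : V -> nat).
Implicit Type y : U + V -> R.

(** Summing over the matching gives an unmatched vertex gain 0 without a case distinction. *)
Definition online_gain y u : R :=
  \sum_(e in ranking_matching g E w idV y | e.1 == u)
    w e.2 * (1 - g (y (inr e.2)) (y (inl e.1))).

Definition offline_gain y v : R :=
  \sum_(e in ranking_matching g E w idV y | e.2 == v)
    w e.2 * g (y (inr e.2)) (y (inl e.1)).

Hypothesis g01 : forall x b, 0 <= g x b <= 1.
Hypothesis w0 : forall v, 0 <= w v.

Lemma online_term_ge0 y e : 0 <= w e.2 * (1 - g (y (inr e.2)) (y (inl e.1))).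
Proof. by rewrite mulr_ge0// subr_ge0; case/andP: (g01 (y (inr e.2)) (y (inl e.1))). Qed.

Lemma offline_term_ge0 y e : 0 <= w e.2 * g (y (inr e.2)) (y (inl e.1)).
Proof. by rewrite mulr_ge0//; case/andP: (g01 (y (inr e.2)) (y (inl e.1))). Qed.

Lemma online_gain_ge0 y u : 0 <= online_gain y u.
Proof. by apply: sumr_ge0 => e _; exact: online_term_ge0. Qed.

Lemma offline_gain_ge0 y v : 0 <= offline_gain y v.
Proof. by apply: sumr_ge0 => e _; exact: offline_term_ge0. Qed.

Lemma online_gain_ge y u v : (u, v) \in ranking_matching g E w idV y ->
  w v * (1 - g (y (inr v)) (y (inl u))) <= online_gain y u.
Proof.
move=> uv; rewrite /online_gain (bigD1 (u, v)) ?uv ?eqxx//= lerDl.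
by apply: sumr_ge0 => e _; exact: online_term_ge0.
Qed.

Lemma offline_gain_ge y u v : (u, v) \in ranking_matching g E w idV y ->
  w v * g (y (inr v)) (y (inl u)) <= offline_gain y v.
Proof.
move=> uv; rewrite /offline_gain (bigD1 (u, v)) ?uv ?eqxx//= lerDl.
by apply: sumr_ge0 => e _; exact: offline_term_ge0.
Qed.

Hypothesis idV_inj : injective idV.

Lemma total_gain y :
  \sum_u online_gain y u + \sum_v offline_gain y v =
  matching_weight w (ranking_matching g E w idV y).
Proof.
rewrite /online_gain /offline_gain.
rewrite [X in X + _](_ : _ = \sum_(e in ranking_matching g E w idV y)
    w e.2 * (1 - g (y (inr e.2)) (y (inl e.1)))); last first.
  by rewrite [RHS](partition_big (@fst U V) xpredT).
rewrite [X in _ + X](_ : _ = \sum_(e in ranking_matching g E w idV y)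
    w e.2 * g (y (inr e.2)) (y (inl e.1))); last first.
  by rewrite [RHS](partition_big (@snd U V) xpredT).
rewrite -big_split/= /matching_weight /matched_offline big_imset/=; last first.
  exact: ranking_snd_inj.
by apply: eq_bigr => e _; ring.
Qed.

End Gains.

Section Edge.
Variables (R : realType) (g : R -> R -> R).
Variables (U V : finType) (E : U -> V -> bool) (w : V -> R) (idV : V -> nat).
Hypothesis g01 : forall x b, 0 <= g x b <= 1.
Hypothesis g_ndx : forall x x' b, x <= x' -> g x b <= g x' b.
Hypothesis g_niy : forall x b b', b <= b' -> g x b' <= g x b.
Hypothesis g_diff : forall x b b', b <= b' -> g 1 b' - g x b' <= g 1 b - g x b.
Hypothesis w0 : forall v, 0 <= w v.
Hypothesis idV_inj : injective idV.
Variables (z : U + V -> R) (u : U) (v : V).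
Hypothesis Euv : E u v.
Hypothesis z1 : forall v', z (inr v') <= 1.

Local Notation draw := (redraw z u v).
Let pr x b := preferred g w idV (draw x b).

Let others : seq U :=
  sort (fun u u' => z (inl u) <= z (inl u')) [seq u' <- enum U | u' != u].

(** Read off from the actual arrival order, so that ties at time [b] are broken as they are there.
    The rank 0 of [v] is a placeholder, since arrival times do not depend on it. *)
Let rank b := index u (arrival_order (draw 0 b)).

Let before b := take (rank b) others.

(* [alive x n] and [without_uv n] describe the state after the first [n] arrivals of online
   vertices other than [u], with [u] removed, respectively with both [u] and [v] removed. *)
Let alive x n := v \in run E (pr x 0) [set: V]%SET (take n others).

Let without_uv n := run E (pr 0 0) (~: [set v])%SET (take n others).

Let prL x b : linear_prefs (pr x b).
Proof. exact: preferred_linear. Qed.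

Let others_neq u' : u' \in others -> u' != u.
Proof. by rewrite mem_sort mem_filter => /andP[]. Qed.

Let take_neq n u' : u' \in take n others -> u' != u.
Proof. by move=> /mem_take; exact: others_neq. Qed.

Let arrival_split x b : exists q,
  [/\ arrival_order (draw x b) = before b ++ u :: q, before b ++ q = others,
    forall u', u' \in before b -> z (inl u') <= b &
    forall u', u' \in q -> b <= z (inl u')].
Proof.
have us : u \in arrival_order (draw 0 b) by rewrite mem_sort mem_enum.
have unis : uniq (arrival_order (draw 0 b)) by rewrite sort_uniq enum_uniq.
have tot : total (fun u1 u2 : U => draw 0 b (inl u1) <= draw 0 b (inl u2)).
  by move=> a c; exact: le_total.
have tr : transitive (fun u1 u2 : U => draw 0 b (inl u1) <= draw 0 b (inl u2)).
  by move=> a c d; exact: le_trans.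
have := sort_sorted tot (enum U).
have : [seq u' <- arrival_order (draw 0 b) | u' != u] = others.
  rewrite /arrival_order filter_sort//; rewrite /others.
  (* The two orders agree only away from [u], so the sequence is lifted to the subtype of vertices
     other than [u], where they are the same relation. *)
  have /all_sigP[l ->] : all (predC1 u) [seq u' <- enum U | u' != u].
    by apply/allP => a; rewrite mem_filter => /andP[].
  rewrite !sort_map; congr (map _ (sort _ _)); apply/funext => -[a au].
  by apply/funext => -[c cu]; rewrite /= (negbTE au) (negbTE cu).
rewrite -/(arrival_order (draw 0 b)) sorted_pairwise//.
rewrite -[arrival_order (draw x b)]/(arrival_order (draw 0 b)) /before /rank.
case/splitPr: us unis => p q; rewrite cat_uniq/= negb_or => /and4P[_ /andP[up _] uq _].
rewrite filter_cat/= eqxx/=.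
rewrite (all_filterP _); last by apply/allP => a ap; apply: contraNneq up => <-.
rewrite (all_filterP _); last by apply/allP => a aq; apply: contraNneq uq => <-.
move=> pq; rewrite pairwise_cat/= => /and3P[/allrelP hpq _ /andP[/allP hq _]].
rewrite index_cat (negbTE up)/= eqxx addn0 -pq take_size_cat//.
exists q; split=> //.
  move=> u' u'p; have := hpq u' u u'p (mem_head _ _).
  by rewrite /= eqxx ifN//; apply: contraNneq up => <-.
move=> u' u'q; have := hq u' u'q.
by rewrite /= eqxx ifN//; apply: contraNneq uq => <-.
Qed.

(** Justifies the placeholder 0 for the arrival time of [u] in [alive] and [without_uv]: the other
    online vertices never see it. *)
Let pr_time x b b' u' : u' != u -> pr x b u' =2 pr x b' u'.
Proof. by move=> /negbTE u'u a c; rewrite /pr /preferred /score /= u'u. Qed.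

Let pr_agree x b x' b' u' a c :
  u' != u -> a != v -> c != v -> pr x b u' a c = pr x' b' u' a c.
Proof.
move=> /negbTE u'u /negbTE av /negbTE cv.
by rewrite /pr /preferred /score /= u'u av cv.
Qed.

Let pr_worse x x' b u' a : x <= x' -> pr x' b u' v a -> pr x b u' v a.
Proof.
move=> xx'; rewrite /pr /preferred /score /= eqxx; case: eqVneq => [->|_].
  by move=> _; rewrite eqxx leqnn orbT.
set c := (if u' == u then b else z (inl u')).
have h : w v * (1 - g x' c) <= w v * (1 - g x c).
  by apply: ler_wpM2l => //; rewrite lerB// g_ndx.
case: (ltgtP (w a * _) (w v * (1 - g x c))) => //=.
- by move=> h'; rewrite lt_gtF ?(le_lt_trans h)//= gt_eqF// (le_lt_trans h).
- by move=> ->; rewrite ltNge h /= => /andP[].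
Qed.

Let setTE : [set: V]%SET = (v |: ~: [set v])%SET.
Proof. by rewrite finset.setUCr. Qed.

Let v_notin : v \notin (~: [set v])%SET.
Proof. by rewrite !inE eqxx. Qed.

Let run_time x b n A : run E (pr x b) A (take n others) = run E (pr x 0) A (take n others).
Proof. by apply: run_eq_prefs => u' a c /take_neq u'u; exact: pr_time. Qed.

Let run_without x b n :
  run E (pr x b) (~: [set v])%SET (take n others) = without_uv n.
Proof.
apply: (run_ext E v_notin) => u' a c /take_neq u'u av cv.
exact: pr_agree.
Qed.

Let alive_run x b n : alive x n ->
  run E (pr x b) [set: V]%SET (take n others) = (v |: without_uv n)%SET.
Proof.
rewrite /alive -(run_time x b) setTE => /(run_setU1 (@prL x b) v_notin) ->.
by rewrite run_without.
Qed.

Let without_sub x b n :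
  without_uv n \subset run E (pr x b) [set: V]%SET (take n others).
Proof. by rewrite -(run_without x b); exact: run_mono (@prL x b) (finset.subsetT _). Qed.

Let alive_mono x x' n : x <= x' -> alive x n -> alive x' n.
Proof.
move=> xx'; rewrite /alive setTE; apply: run_worse_rank => //.
- by move=> u' a c /take_neq u'u av cv; exact: pr_agree.
- by move=> u' a _; exact: pr_worse.
Qed.

Let run_take_sub x b m n A : (m <= n)%N ->
  run E (pr x b) A (take n others) \subset run E (pr x b) A (take m others).
Proof.
move=> mn; rewrite -{1}(subnKC mn) takeD run_cat; exact: run_subset.
Qed.

Let rank_mono b b' : b < b' -> (rank b <= rank b')%N.
Proof.
move=> bb'; have [q [arr e hp _]] := arrival_split 0 b.
have [q' [_ e' _ hq']] := arrival_split 0 b'.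
have rs c : (rank c < size others)%N -> size (before c) = rank c.
  by move=> h; rewrite /before size_take h.
rewrite leqNgt; apply/negP => lt.
have szo : (rank b <= size others)%N.
  have := erefl (size (arrival_order (draw 0 b))).
  rewrite {2}arr size_cat /= addnS -size_cat e => szE.
  by rewrite -ltnS -szE index_mem mem_sort mem_enum.
have lt' : (rank b' < size others)%N by exact: leq_trans lt szo.
(* If [u] came later for [b] than for [b'], then [u0] would arrive before [u] in the first case and
   after it in the second, which forces [b' <= b]. *)
pose u0 := nth u others (rank b').
have h1 : u0 \in before b.
  rewrite /u0 -(nth_take u lt); apply: mem_nth.
  by rewrite /before size_take; case: ifP.
have h2 : u0 \in q'.
  rewrite /u0 -{1}e' nth_cat (rs _ lt') ltnn subnn; apply: mem_nth.
  by have := congr1 size e'; rewrite size_cat (rs _ lt') => sz; rewrite -(ltn_add2l (rank b')) addn0 sz.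
by have := lt_le_trans bb' (le_trans (hq' _ h2) (hp _ h1)); rewrite ltxx.
Qed.

(* The default 2 exceeds every arrival time and stands for [v] remaining unmatched. *)
Definition matched_time x : R :=
  \big[Order.min/2]_(n < size others | ~~ alive x n.+1) z (inl (nth u others n)).

(** The competitor [v'] is sought in [without_uv], a set that does not depend on [x]. It therefore
    remains available for every rank of [v]. *)
Definition displaced b x : Prop := alive x (rank b) /\
  exists v', [/\ v' \in without_uv (rank b), E u v' &
                 w v * (1 - g x b) <= w v' * (1 - g (z (inr v')) b)].

Lemma matched_time_nd x x' : x <= x' -> matched_time x <= matched_time x'.
Proof.
move=> xx'; apply/bigmin_geP; split=> [|n na]; first exact: bigmin_le_id.
by apply: bigmin_le_cond; apply: contra na; exact: alive_mono.
Qed.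

Lemma displaced_nd b x x' : x <= x' -> displaced b x -> displaced b x'.
Proof.
move=> xx' [ax [v' [v'A Ev' h]]]; split; first exact: alive_mono ax.
exists v'; split=> //; apply: le_trans h.
by apply: ler_wpM2l => //; rewrite lerB// g_ndx.
Qed.

(** Fewer vertices are taken by time [b], so [v] and [v'] are still free. For [w v <= w v'] the
    comparison follows from monotonicity in the rank. Otherwise the advantage of [v'] is [w v' * (g
    1 b - g x b) - (w v - w v') * (1 - g 1 b)]; going back in time, the first product grows by
    [g_diff] and the second shrinks by [g_niy]. *)
Lemma displaced_ni b b' : b < b' -> displaced b' 1 -> displaced b 1.
Proof.
move=> bb' [a1 [v' [v'A Ev' h]]]; have rr := rank_mono bb'; split.
  rewrite /alive; move: a1; apply/fintype.subsetP; exact: run_take_sub.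
exists v'; split=> //.
  move: v'A; apply/fintype.subsetP; exact: run_take_sub.
set x := z (inr v') in h *.
have gx1 c : g x c <= g 1 c by apply: g_ndx; exact: z1.
have d := g_diff x (ltW bb').
have hb : g 1 b' <= g 1 b by exact/g_niy/ltW.
have wv := w0 v; have wv' := w0 v'.
have [b1 b1'] : 0 <= 1 - g 1 b /\ 0 <= 1 - g 1 b'.
  by rewrite !subr_ge0; case/andP: (g01 1 b) => _ ->; case/andP: (g01 1 b') => _ ->.
have := gx1 b; have [ww|/ltW ww] := leP (w v) (w v'); nra.
Qed.

Section FixDraw.
Variables x b : R.
Let M := ranking_matching g E w idV (draw x b).
Let onl := online_gain g E w idV (draw x b) u.
Let off := offline_gain g E w idV (draw x b) v.

Let off_ge c u' : (u', v) \in M -> draw x b (inl u') <= c -> w v * g x c <= off.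
Proof.
move=> uM uc; apply: le_trans (offline_gain_ge g01 w0 uM).
by rewrite [draw x b (inr v)]/= eqxx ler_wpM2l// g_niy.
Qed.

(** Adding [u] can only make [v] be matched earlier, and [g] is larger at earlier times. *)
Let not_alive_off n : (n < size others)%N -> ~~ alive x n.+1 ->
  w v * g x (z (inl (nth u others n))) <= off.
Proof.
move=> nlt; rewrite /alive -(run_time x b).
have [q [arr e hp hq]] := arrival_split x b.
set c := z _.
have srt u' : u' \in take n.+1 others -> z (inl u') <= c.
  move=> /(nthP u)[i]; rewrite size_take => ilt <-.
  have il : (i < n.+1)%N by move: ilt; case: ifP => // h ilt; apply: leq_trans ilt _; rewrite leqNgt h.
  rewrite nth_take// /c.
  have tot : total (fun u u' : U => z (inl u) <= z (inl u')) by move=> ? ?; exact: le_total.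
  have tr : transitive (fun u u' : U => z (inl u) <= z (inl u')) by move=> ? ? ?; exact: le_trans.
  apply: (sorted_leq_nth tr _ u (sort_sorted tot _)) => //=; rewrite ?inE//.
  by rewrite (leq_trans il).
have drawE u' : u' \in others -> draw x b (inl u') = z (inl u').
  by move=> /others_neq/negbTE /= ->.
(* If the first [n.+1] other vertices all precede [u], then the presence of [u] has no effect on
   them. *)
have [le|gt] := leqP n.+1 (size (before b)).
  have tE : take n.+1 others = take n.+1 (arrival_order (draw x b)).
    by rewrite arr -e !takel_cat.
  move=> /(steps_matched (drop n.+1 (arrival_order (draw x b))))[u' u't].
  rewrite [in X in X -> _]tE cat_take_drop => uM; apply: off_ge uM _.
  by rewrite drawE ?srt// (mem_take u't).
have tE : take n.+1 others = before b ++ take (n.+1 - size (before b)) q.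
  by rewrite -{1}e take_cat ltnNge (ltnW gt).
set q1 := take _ q in tE.
have bc : b <= c.
  have : nth u others n \in q.
    rewrite -{1}e nth_cat ltnNge -ltnS gt /=; apply: mem_nth.
    by rewrite ltn_subLR// -size_cat e.
  exact: hq.
have sE : arrival_order (draw x b) = (before b ++ u :: q1) ++ drop (n.+1 - size (before b)) q.
  by rewrite arr -catA /= cat_take_drop.
move=> nv.
(* The step of [u] only shrinks the free set, so by [run_mono] the vertex [v] is gone here as well,
   taken by [u] or by some other vertex, in either case no later than [c]. *)
have : v \notin run E (pr x b) [set: V]%SET (before b ++ u :: q1).
  apply: contra nv; rewrite tE !run_cat /=; apply/fintype.subsetP.
  exact: run_mono (@prL x b) (step_subset _ _ _ _).
move=> /(steps_matched (drop (n.+1 - size (before b)) q))[u' u't].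
rewrite -sE => uM; apply: off_ge uM _.
have [->|u'u] := eqVneq u' u; first by rewrite /= eqxx.
have u'o : u' \in take n.+1 others.
  by rewrite tE; move: u't; rewrite !mem_cat inE (negbTE u'u).
by rewrite drawE ?srt// (mem_take u'o).
Qed.

Lemma offline_gain_matched_time : matched_time x <= 1 ->
  w v * g x (matched_time x) <= off.
Proof.
move=> t1; have /bigmin_leP[|[n na le]] := lexx (matched_time x).
  by move=> /le_trans/(_ t1); lra.
apply: le_trans (not_alive_off (ltn_ord n) na).
by rewrite ler_wpM2l// g_niy.
Qed.

Let choice_u : alive x (rank b) -> ~ displaced b x -> (u, v) \in M.
Proof.
move=> al nd; have [q [arr _ _ _]] := arrival_split x b.
rewrite /M /ranking_matching arr; apply: steps_choice => //.
rewrite alive_run//; apply: best_choice; first exact: prL.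
apply/bestP; split=> //; first by rewrite !inE eqxx.
move=> v' v'A Ev'; rewrite /preferred /score /= !eqxx.
have [->|v'v] := eqVneq v' v; first by rewrite eqxx leqnn orbT.
apply/orP; left; rewrite ltNge; apply/negP => h; apply: nd; split=> //.
by exists v'; split=> //; move: v'A; rewrite !inE (negbTE v'v).
Qed.

(** Either [v] is free when [u] arrives and [u] takes it at time [b], or [v] was matched before. *)
Lemma offline_gain_not_displaced : ~ displaced b x -> w v * g x b <= off.
Proof.
move=> nd; have [q [arr _ hp _]] := arrival_split x b.
have [al|] := boolP (alive x (rank b)).
  by apply: (off_ge (choice_u al nd)); rewrite /= eqxx.
rewrite /alive -(run_time x b).
move=> /(steps_matched (u :: q))[u' u't].
rewrite -[take _ _]/(before b) -arr => uM; apply: off_ge uM _.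
by rewrite /= (negbTE (take_neq u't)); exact: hp.
Qed.

(** The competitor that displaces [x0] is free for every [x], by monotonicity of runs in the free
    set, and its score does not involve the rank of [v]. Hence [u] takes a vertex that scores at
    least as much. *)
Lemma online_gain_displaced x0 : displaced b x0 -> w v * (1 - g x0 b) <= onl.
Proof.
move=> [_ [v' [v'A Ev' h]]]; have [q [arr _ _ _]] := arrival_split x b.
have v'r : v' \in run E (pr x b) [set: V]%SET (before b).
  by move: v'A; apply/fintype.subsetP; exact: without_sub.
have [v2 ch pv] := choice_exists (@prL x b) v'r Ev'.
have uM : (u, v2) \in M.
  by rewrite /M /ranking_matching arr; apply: steps_choice.
apply: le_trans h (le_trans _ (online_gain_ge g01 w0 uM)).
have v'v : v' != v.
  apply: contraTneq v'A => ->; apply: contra v_notin.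
  by apply/fintype.subsetP; exact: run_subset.
move: pv; rewrite /pr /preferred /score /= eqxx (negbTE v'v).
by case/orP => [/ltW//|/andP[/eqP ->]].
Qed.

Lemma gain_not_displaced : ~ displaced b x -> b < matched_time x -> w v <= onl + off.
Proof.
move=> nd bt; have al : alive x (rank b).
  have [//|na] := boolP (alive x (rank b)).
  (* If [v] were already taken, the last arrival before [u], with index [m] and time at most [b],
     would bound [matched_time x] from above. *)
  case rE : (rank b) na => [|m] na; first by rewrite /alive take0 inE in na.
  have [q [arr e hp _]] := arrival_split x b.
  have [ms|sm] := ltnP m (size others).
    have : matched_time x <= z (inl (nth u others m)).
      by rewrite (@bigmin_le_cond _ _ _ _ (Ordinal ms)
        (fun n : 'I__ => ~~ alive x n.+1) (fun n : 'I__ => z (inl (nth u others n)))).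
    move=> /(lt_le_trans bt); rewrite ltNge hp//.
    rewrite /before rE -(@nth_take m.+1)//; apply: mem_nth.
    by rewrite size_take; case: ifP.
  (* For [m] beyond the end of [others], [take] returns the whole sequence, so its last element
     plays the same role. *)
  have [ns0|s0] := posnP (size others).
    by move: na; rewrite /alive (size0nil ns0) inE.
  have ms : ((size others).-1 < size others)%N by rewrite prednK.
  have na' : ~~ alive x (size others).-1.+1.
    by move: na; rewrite /alive prednK// take_size take_oversize// (leq_trans sm).
  have : matched_time x <= z (inl (nth u others (size others).-1)).
    by rewrite (@bigmin_le_cond _ _ _ _ (Ordinal ms)
        (fun n : 'I__ => ~~ alive x n.+1) (fun n : 'I__ => z (inl (nth u others n)))).
  move=> /(lt_le_trans bt); rewrite ltNge hp//.
  rewrite /before take_oversize ?rE ?(leq_trans sm)//; exact: mem_nth.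
have uM := choice_u al nd.
have := lerD (online_gain_ge g01 w0 uM) (offline_gain_ge g01 w0 uM).
by apply: le_trans; rewrite -mulrDr subrK mulr1.
Qed.

End FixDraw.
End Edge.

(** * Dini derivatives *)

Section Dini.
Variable R : realType.
Implicit Types (f phi : R -> R) (a b c x : R).

Lemma upper_dini_right_lt f x c (e : R) : 0 < e ->
  (upper_dini_right f x <= c%:E)%E ->
  exists2 d, 0 < d & forall h, 0 < h < d -> f (x + h) - f x <= (c + e) * h.
Proof.
move=> e0 fc; have : (upper_dini_right f x < (c + e)%:E)%E.
  by apply: le_lt_trans fc _; rewrite lte_fin ltrDl.
move=> /ereal_inf_lt[_ [V V0 <-] sup_lt].
move: V0; rewrite /at_right /within/= => /nbhs_ballP[d /= d0 dV].
exists d => // h /andP[h0 hd].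
have Vh : V h by apply: dV => //=; rewrite /ball/= sub0r normrN gtr0_norm.
rewrite -ler_pdivrMr// -lee_fin; apply: (le_trans _ (ltW sup_lt)).
by apply: ereal_sup_ubound; exists h.
Qed.

Lemma lower_dini_right_gt f x c (e : R) : 0 < e ->
  (c%:E <= lower_dini_right f x)%E ->
  exists2 d, 0 < d & forall h, 0 < h < d -> (c - e) * h <= f (x + h) - f x.
Proof.
move=> e0 fc; have h : (upper_dini_right (fun s : R => (- f s)%R) x <= (- c)%:E)%E.
  move: fc; rewrite /lower_dini_right /limf_einf leeNr => fc.
  rewrite EFinN; apply: le_trans fc; rewrite le_eqVlt; apply/orP; left; apply/eqP.
  congr limf_esup; apply/funext => k; rewrite /diff_quot /=; congr EFin.
  by rewrite -mulNr; congr (_ / _); ring.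
have [d d0 dh] := upper_dini_right_lt e0 h.
by exists d => // k kd; have /= := dh k kd; lra.
Qed.

(* Continuous induction: the left condition lets the induction pass to suprema, the right one
   continues past them. *)
Lemma right_dini_le0_noninc phi a b : a <= b ->
  (forall x e, a <= x < b -> 0 < e ->
     exists2 d, 0 < d & forall h, 0 < h < d -> phi (x + h) <= phi x + e * h) ->
  (forall x e, a < x <= b -> 0 < e ->
     exists2 d, 0 < d & forall h, 0 < h < d -> phi x <= phi (x - h) + e) ->
  phi b <= phi a.
Proof.
move=> ab right left; apply/ler_addgt0Pr => e e0.
(* A slope whose total over the interval is at most [e]; the summand 1 keeps the denominator
   positive when [a = b]. *)
pose k := e / (b - a + 1).
have k0 : 0 < k by rewrite divr_gt0//; lra.
suff h : phi b <= phi a + k * (b - a).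
  apply: (le_trans h); rewrite lerD2l /k mulrAC ler_pdivrMr; last by lra.
  by rewrite ler_pM2l//; lra.
pose S := [set x | a <= x <= b /\ forall y, a <= y <= x -> phi y <= phi a + k * (y - a)].
have Sa : S a.
  split=> [|y /andP[ay ya]]; first by rewrite lexx ab.
  have -> : y = a by apply/le_anti; rewrite ay ya.
  by rewrite subrr mulr0 addr0.
have Sb : ubound S b by move=> x [/andP[]].
have Ssup : has_sup S by split; [exists a | exists b].
set c := sup S.
have ac : a <= c by exact: sup_upper_bound.
have cb : c <= b by apply: ge_sup => //; exists a.
have below y : a <= y < c -> phi y <= phi a + k * (y - a).
  move=> /andP[ay yc]; have [s [_ Ss] ys] := sup_gt (ex_intro _ a Sa) yc.
  by apply: Ss; rewrite ay ltW.
have atc : phi c <= phi a + k * (c - a).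
  move: ac; rewrite le_eqVlt => /orP[/eqP <-|ac]; first by rewrite subrr mulr0 addr0.
  apply/ler_addgt0Pr => e' e'0.
  have [|d d0 dh] := left c e' _ e'0; first by rewrite ac.
  pose h := Num.min (d / 2) ((c - a) / 2).
  have h0 : 0 < h by rewrite lt_min; apply/andP; split; lra.
  have hd : h <= d / 2 by rewrite ge_min lexx.
  have hc : h <= (c - a) / 2 by rewrite ge_min lexx orbT.
  have := dh h; rewrite h0 /= => /(_ ltac:(lra)) /le_trans; apply.
  rewrite lerD2r; apply: le_trans (below (c - h) _) _; first by apply/andP; split; lra.
  by rewrite lerD2l ler_pM2l//; lra.
move: cb; rewrite le_eqVlt => /orP[/eqP <-//|cb].
(* If [c < b], the right condition puts a point [c + h] beyond the supremum into [S]. *)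
have [|d d0 dh] := right c k _ k0; first by rewrite ac.
pose h := Num.min (d / 2) (b - c).
have h0 : 0 < h by rewrite lt_min; apply/andP; split; lra.
have hd : h <= d / 2 by rewrite ge_min lexx.
have hb : h <= b - c by rewrite ge_min lexx orbT.
have : S (c + h).
  split=> [|y /andP[ay yh]]; first by apply/andP; split; lra.
  have [yc|cy] := ltP y c; first by rewrite below// ay.
  move: cy; rewrite le_eqVlt => /orP[/eqP <-//|cy].
  have := dh (y - c); rewrite [c + _]addrC subrK => /(_ ltac:(lra)) /le_trans; apply.
  by have := atc; nra.
by move=> /(sup_upper_bound Ssup); rewrite -/c; lra.
Qed.

End Dini.

(** * Integrals of continuous functions over closed intervals *)

Section RintegralContinuous.
Variable R : realType.
Implicit Types (f : R -> R) (a b c : R).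
Let mu := @lebesgue_measure R.

Lemma continuous_integrable_itv f a b : continuous f ->
  mu.-integrable `[a, b] (EFin \o f).
Proof.
move=> cf; apply: continuous_compact_integrable; first exact: segment_compact.
exact: continuous_subspaceT.
Qed.

Lemma Rintegral_itv_addl f a b c : continuous f -> a <= b -> b <= c ->
  \int[mu]_(x in `[a, c]) f x =
  \int[mu]_(x in `[a, b]) f x + \int[mu]_(x in `[b, c]) f x.
Proof.
move=> cf ab bc; apply/eqP; rewrite -subr_eq0 opprD addrA subr_eq0; apply/eqP.
rewrite Rintegral_itvB//; [|exact: continuous_integrable_itv].
rewrite Rintegral_itv_obnd_cbnd//.
apply: integrableS (continuous_integrable_itv b c cf) => //.
by apply: subset_itv_oc_cc.
Qed.

Lemma le_cst_Rintegral f a b k : continuous f -> a <= b ->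
  (forall x, a <= x <= b -> k <= f x) -> k * (b - a) <= \int[mu]_(x in `[a, b]) f x.
Proof.
move=> cf ab kf.
have -> : k * (b - a) = \int[mu]_(x in `[a, b]) (cst k x).
  rewrite Rintegral_cst//= lebesgue_measure_itv/= lte_fin.
  by move: ab; rewrite le_eqVlt => /orP[/eqP ->|->//]; rewrite ltxx subrr.
apply: le_Rintegral => //; first exact: continuous_integrable_itv (@cst_continuous _ _ _).
exact: continuous_integrable_itv.
Qed.

End RintegralContinuous.

(** * Integrated forms of the derivative conditions *)

Section GConsequences.
Variables (R : realType).
Let mu := @lebesgue_measure R.

(** Condition (3), integrated. Since [f] is non-decreasing, its integral over [[x, x + h]] is at
    least [h * f x], so [f] minus its integral has nonpositive upper right Dini derivative. Here
    [f0] is a section of the given [g] and [f] the one of its extension to the plane. *)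
Lemma deriv_le01_growth (f f0 : R -> R) a b : continuous f ->
  (forall x y, x <= y -> f x <= f y) -> (forall x, 0 <= f x) ->
  (forall x, 0 <= x <= 1 -> f0 x = f x) -> deriv_le01 f0 f0 -> 0 <= a -> a <= b -> b <= 1 ->
  f b - f a <= \int[mu]_(x in `[a, b]) f x.
Proof.
move=> cf f_nd f_ge0 ff [f_right _] a0 ab b1.
pose phi x := f x - \int[mu]_(s in `[a, x]) f s.
suff : phi b <= phi a.
  by rewrite /phi set_itv1 Rintegral_set1; lra.
apply: right_dini_le0_noninc => // [x e|x e] /andP[ax xb] e0.
  have x01 : 0 <= x < 1 by apply/andP; split; lra.
  have [d d0 dh] := upper_dini_right_lt e0 (f_right x x01).
  exists (Num.min d (b - x)) => [|h]; first by rewrite lt_min d0; lra.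
  rewrite lt_min => /and3P[h0 hd hb].
  have := dh h; rewrite h0 hd !ff => [/(_ erefl)||]; [|lra|lra].
  rewrite /phi (@Rintegral_itv_addl _ f a x (x + h))//; last by lra.
  have := @le_cst_Rintegral _ f x (x + h) (f x) cf ltac:(lra) (fun y yx => f_nd x y (andP yx).1).
  by nra.
have /cvgrPdist_lt/(_ e e0) : f y @[y --> x] --> f x by exact: cf.
move=> /nbhs_ballP[d /= d0 dV].
exists (Num.min d (x - a)) => [|h]; first by rewrite lt_min d0; lra.
rewrite lt_min => /and3P[h0 hd hxa].
have := dV (x - h); rewrite /ball/= opprB addrC subrK gtr0_norm// => /(_ hd).
rewrite /phi (@Rintegral_itv_addl _ f a (x - h) x)//; [|lra|lra].
have : 0 <= \int[mu]_(s in `[x - h, x]) f s by exact: Rintegral_ge0.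
by have := ler_norm (f x - f (x - h)); lra.
Qed.

(** Condition (4), integrated, with the linear factor [1 + a - y] in place of an exponential.
    Formally the derivative of [phi] is [- (1 - f y) - (1 + a - y) * f' y], which is nonpositive
    because [f' y >= f y - 1] and the factor lies in [0, 1]. *)
Lemma deriv_ge01_decay (f f0 : R -> R) a b : continuous f ->
  (forall y, 0 <= f y <= 1) -> (forall x, 0 <= x <= 1 -> f0 x = f x) ->
  deriv_ge01 f0 (fun y => f0 y - 1) ->
  0 <= a -> a <= b -> b <= 1 ->
  (1 + a - b) * (1 - f b) <= 1 - f a.
Proof.
move=> cf f01 ff [f_right _] a0 ab b1.
pose phi y := (1 + a - y) * (1 - f y).
suff : phi b <= phi a by rewrite /phi; lra.
apply: right_dini_le0_noninc => // [x e|x e] /andP[ax xb] e0.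
  have x01 : 0 <= x < 1 by apply/andP; split; lra.
  have [d d0 dh] := lower_dini_right_gt e0 (f_right x x01).
  exists (Num.min d (b - x)) => [|h]; first by rewrite lt_min d0; lra.
  rewrite lt_min => /and3P[h0 hd hb].
  have := dh h; rewrite h0 hd !ff => [/(_ erefl)||]; [|lra|lra].
  have /andP[fx0 fx1] := f01 x; rewrite /phi => hh.
  set F := f (x + h) in hh *; set c := 1 + a - x - h.
  have c0 : 0 <= c by rewrite /c; lra.
  have c1 : c <= 1 by rewrite /c; lra.
  have : c * ((f x - 1 - e) * h) <= c * (F - f x) by rewrite ler_wpM2l.
  have ch : c * h <= h by rewrite ler_piMl// ltW.
  have : (c * h) * (1 - f x) <= h * (1 - f x) by rewrite ler_wpM2r//; lra.
  have : (c * h) * e <= h * e by rewrite ler_wpM2r// ltW.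
  have -> : 1 + a - (x + h) = c by rewrite /c; ring.
  have -> : 1 + a - x = c + h by rewrite /c; ring.
  lra.
have cphi : continuous phi.
  move=> y; apply: cvgM; apply: cvgB; [exact: cvg_cst|exact: cvg_id|exact: cvg_cst|exact: cf].
have /cvgrPdist_lt/(_ e e0) : phi y @[y --> x] --> phi x by exact: cphi.
move=> /nbhs_ballP[d /= d0 dV]; exists d => // h /andP[h0 hd].
have := dV (x - h); rewrite /ball/= opprB addrC subrK gtr0_norm// => /(_ hd).
by have := ler_norm (phi x - phi (x - h)); lra.
Qed.

End GConsequences.

(** * The bound for two uniform draws *)

Section IntegralTools.
Local Open Scope ereal_scope.

(* Applied to [inner_min], whose measurability is then not needed. *)
Lemma ge0_le_integral_nonmeasurable d (T : measurableType d) (R : realType)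
    (mu : {measure set T -> \bar R}) (D : set T) (f h : T -> \bar R) :
  (forall x, D x -> 0 <= f x) -> (forall x, D x -> f x <= h x) ->
  \int[mu]_(x in D) f x <= \int[mu]_(x in D) h x.
Proof.
move=> f0 fh; have h0 x : D x -> 0 <= h x.
  by move=> Dx; apply: le_trans (fh x Dx); exact: f0.
rewrite !ge0_integralE//; apply: le_ereal_sup => _ [k kf <-].
exists k => // x; apply: le_trans (kf x) _; rewrite /patch; case: ifPn => //.
by rewrite inE; exact: fh.
Qed.

Lemma ge0_disjoint_integral_le d (T : measurableType d) (R : realType)
    (mu : {measure set T -> \bar R}) (D1 D2 D : set T) (f : T -> \bar R) :
  measurable D1 -> measurable D2 -> measurable D -> measurable_fun setT f ->
  (forall x, 0 <= f x) -> D1 `<=` D -> D2 `<=` D -> D1 `&` D2 = set0 ->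
  \int[mu]_(x in D1) f x + \int[mu]_(x in D2) f x <= \int[mu]_(x in D) f x.
Proof.
move=> mD1 mD2 mD mf f0 D1D D2D D12.
rewrite -ge0_integral_setU//=.
- apply: ge0_subset_integral => //; first exact: measurableU.
  + exact: measurable_funTS.
  + by move=> x [/D1D|/D2D].
- exact: measurable_funTS.
- exact/disj_set2P.
Qed.

Lemma fine_le_self (R : realType) (x : \bar R) : 0 <= x -> (fine x)%:E <= x.
Proof. by case: x => //= _; rewrite leey. Qed.

Section FubiniOnSets.
Context d1 d2 (T1 : measurableType d1) (T2 : measurableType d2) (R : realType).
Variables (m1 : {sigma_finite_measure set T1 -> \bar R}).
Variables (m2 : {sigma_finite_measure set T2 -> \bar R}).
Variables (D1 : set T1) (D2 : set T2) (f : T1 * T2 -> \bar R).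
Hypotheses (mD1 : measurable D1) (mD2 : measurable D2).
Hypotheses (mf : measurable_fun setT f) (f0 : forall p, 0 <= f p).

Let patch_measurable (D : set (T1 * T2)) : measurable D -> measurable_fun setT (f \_ D).
Proof. by move=> mD; apply/(measurable_restrictT _ mD); exact: measurable_funTS. Qed.

Let patch_ge0 (D : set (T1 * T2)) p : 0 <= (f \_ D) p.
Proof. by rewrite /patch; case: ifP. Qed.

Lemma measurable_integral_section1 :
  measurable_fun setT (fun x => \int[m2]_(y in D2) f (x, y)).
Proof.
have mD : measurable ([set: T1] `*` D2) by exact: measurableX.
have := measurable_fun_fubini_tonelli_F (m2 := m2) _ (patch_measurable mD) (@patch_ge0 _).
congr measurable_fun; apply/funext => x; rewrite /fubini_F [RHS]integral_mkcond.
apply: eq_integral => y _; rewrite /patch; congr (if _ then _ else _).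
by apply/idP/idP => /set_mem h; apply/mem_set; [exact: h.2|].
Qed.

Lemma measurable_integral_section2 :
  measurable_fun setT (fun y => \int[m1]_(x in D1) f (x, y)).
Proof.
have mD : measurable (D1 `*` [set: T2]) by exact: measurableX.
have := measurable_fun_fubini_tonelli_G (m1 := m1) _ (patch_measurable mD) (@patch_ge0 _).
congr measurable_fun; apply/funext => y; rewrite /fubini_G [RHS]integral_mkcond.
apply: eq_integral => x _; rewrite /patch; congr (if _ then _ else _).
by apply/idP/idP => /set_mem h; apply/mem_set; [exact: h.1|].

Qed.

Lemma fubini_tonelli_sets :
  \int[m1]_(x in D1) \int[m2]_(y in D2) f (x, y) =
  \int[m2]_(y in D2) \int[m1]_(x in D1) f (x, y).
Proof.
have mD : measurable (D1 `*` D2) by exact: measurableX.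
have := fubini_tonelli (m1 := m1) (m2 := m2) _ (patch_measurable mD) (@patch_ge0 _).
rewrite /= => e; rewrite integral_mkcond [RHS]integral_mkcond.
rewrite (eq_integral (fun x => \int[m2]_y (f \_ (D1 `*` D2)) (x, y))).
  rewrite e; apply: eq_integral => y _; rewrite {2}/patch; case: ifPn => yD.
    rewrite [RHS]integral_mkcond; apply: eq_integral => x _; rewrite /patch.
    congr (if _ then _ else _); apply/idP/idP; rewrite !inE; first by case.
    by move=> ?; split=> //; rewrite inE in yD.
  rewrite integral0_eq// => x _; rewrite /patch ifN//.
  by apply: contra yD; rewrite !inE => -[].
move=> x _; rewrite {1}/patch; case: ifPn => xD.
  rewrite integral_mkcond; apply: eq_integral => y _; rewrite /patch.
  congr (if _ then _ else _); apply/idP/idP; rewrite !inE; last by case.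
  by move=> ?; split=> //; rewrite inE in xD.
rewrite integral0_eq// => y _; rewrite /patch ifN//.
by apply: contra xD; rewrite !inE => -[].
Qed.

End FubiniOnSets.
End IntegralTools.

Section Bound.
Variables (R : realType) (g : R -> R -> R).
Let mu := @lebesgue_measure R.
Hypothesis g_cont : continuous (fun p : R * R => g p.1 p.2).
Hypothesis g01 : forall x b, 0 <= g x b <= 1.
Hypothesis g_ndx : forall x x' b, x <= x' -> g x b <= g x' b.
Hypothesis g_niy : forall x b b', b <= b' -> g x b' <= g x b.
Hypothesis g_growth : forall y a b, 0 <= y <= 1 -> 0 <= a -> a <= b -> b <= 1 ->
  g b y - g a y <= \int[mu]_(x in `[a, b]) g x y.
Hypothesis g_decay : forall x a b, 0 <= x <= 1 -> 0 <= a -> a <= b -> b <= 1 ->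
  (1 + a - b) * (1 - g x b) <= 1 - g x a.

Lemma continuous_section1 y : continuous (g ^~ y).
Proof.
move=> x; apply/cvgrPdist_lt => e e0.
have /cvgrPdist_lt/(_ e e0)/nbhs_ballP[d /= d0 dV] := @g_cont (x, y).
apply/nbhs_ballP; exists d => //= s xs; apply: (dV (s, y)).
by split=> //; exact: ballxx.
Qed.

(** By monotonicity, [g > a] at a rational corner [(q, r)] extends to the quadrant [x >= q],
    [y <= r]. By continuity countably many such quadrants cover the superlevel set. *)
Lemma continuous_monotone_measurable_fun : measurable_fun setT (fun p : R * R => g p.1 p.2).
Proof.
apply: (measurability _ (RGenOInfty.measurableE R)) => _ [_ [a ->] <-].
rewrite setTI (_ : _ @^-1` _ = \bigcup_(q : rat) \bigcup_(r : rat)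
  if a < g (ratr q) (ratr r) then `[ratr q, +oo[ `*` `]-oo, ratr r] else set0).
  apply: bigcupT_measurable_rat => q; apply: bigcupT_measurable_rat => r.
  by case: ifP => // _; exact: measurableX.
apply/seteqP; split=> [[x y] /=|[x y] [q _ [r _]]]; last first.
  case: ifP => //= agqr; rewrite !in_itv/= !andbT => -[qx yr].
  exact: lt_le_trans agqr (le_trans (g_ndx _ qx) (g_niy _ yr)).
rewrite in_itv/= andbT => agxy.
have e0 : 0 < g x y - a by rewrite subr_gt0.
have /cvgrPdist_lt/(_ _ e0)/nbhs_ballP[d /= d0 dV] := @g_cont (x, y).
have [q] := @rat_in_itvoo R (x - d) x ltac:(by rewrite ltrBlDr ltrDl).
have [r] := @rat_in_itvoo R y (y + d) ltac:(by rewrite ltrDl).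
rewrite !in_itv/= => /andP[yr rd] /andP[qd qx].
exists q => //; exists r => //; rewrite ifT; last first.
  have := dV (ratr q, ratr r); rewrite /= => /(_ _)/wrap[|].
    by split; rewrite /ball/= ltr_norml; apply/andP; split; lra.
  by rewrite ltr_norml => /andP[]; lra.
by split; rewrite /= in_itv/= ?andbT ltW.
Qed.

Let mg y : measurable_fun setT (g ^~ y).
Proof. by apply: continuous_measurable_fun; exact: continuous_section1. Qed.

Let mgx y : measurable_fun setT (fun x => (g x y)%:E).
Proof. by apply/measurable_EFinP; exact: mg. Qed.

Let RintE y a b : (\int[mu]_(x in `[a, b]) g x y)%:E = (\int[mu]_(x in `[a, b]) (g x y)%:E)%E.
Proof.
rewrite /Rintegral fineK//; apply: integrable_fin_num => //.
exact: (continuous_integrable_itv _ _ (@continuous_section1 y)).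
Qed.

(** Dropping end points, which are null, makes the two integration ranges disjoint and excludes [th]
    and [c], where nothing is known about [Q] and [t]. *)
Lemma inner_objectiveE c tau y th : th <= c ->
  (inner_objective g c tau y th)%:E =
  ((1 - g th y)%:E + (\int[mu]_(x in `[0%R, th[) (g x y)%:E
   + \int[mu]_(x in `]th, c[) (g x tau)%:E))%E.
Proof.
move=> thc; rewrite /inner_objective !EFinD -/mu !RintE -addeA; congr (_ + (_ + _))%E.
  by rewrite -integral_itv_bndo_bndc//; exact: measurable_funTS.
rewrite -integral_itv_bndo_bndc; last exact: measurable_funTS.
by rewrite -integral_itv_obnd_cbnd//; exact: measurable_funTS.
Qed.

Lemma inner_objective_ge0 c tau y th : 0 <= inner_objective g c tau y th.
Proof.
rewrite /inner_objective; apply: addr_ge0; [apply: addr_ge0|]; last 2 first.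
- by apply: Rintegral_ge0 => x _; case/andP: (g01 x y).
- by apply: Rintegral_ge0 => x _; case/andP: (g01 x tau).
- by rewrite subr_ge0; case/andP: (g01 th y).
Qed.

Lemma inner_min_le c tau y th : 0 <= th <= c ->
  inner_min g c tau y <= inner_objective g c tau y th.
Proof.
move=> thc; apply: ge_inf; last by exists th.
by exists 0 => _ [th' _ <-]; exact: inner_objective_ge0.
Qed.

Lemma inner_min_ge0 c tau y : 0 <= c -> 0 <= inner_min g c tau y.
Proof.
move=> c0; apply: lb_le_inf.
  by exists (inner_objective g c tau y 0), 0 => //=; rewrite in_itv/= lexx.
by move=> _ [th' _ <-]; exact: inner_objective_ge0.
Qed.

Lemma outer_objective_ge0 c tau : 0 <= c <= 1 -> 0 <= tau <= 1 ->
  0 <= outer_objective g c tau.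
Proof.
move=> /andP[c0 c1] /andP[t0 t1]; rewrite /outer_objective.
apply: addr_ge0; [apply: addr_ge0|].
- by rewrite mulr_ge0// subr_ge0.
- rewrite mulr_ge0 ?subr_ge0//.
  by apply: Rintegral_ge0 => x _; case/andP: (g01 x tau).
- by apply: Rintegral_ge0 => y _; exact: inner_min_ge0.
Qed.

Lemma ranking_bound_le c tau : 0 <= c <= 1 -> 0 <= tau <= 1 ->
  ranking_bound g <= outer_objective g c tau.
Proof.
move=> c01 t01; apply: ge_inf; last by exists (c, tau).
by exists 0 => _ [[c' t'] [/= c'01 t'01] <-]; apply: outer_objective_ge0.
Qed.

Lemma ranking_bound_ge0 : 0 <= ranking_bound g.
Proof.
apply: lb_le_inf.
  by exists (outer_objective g 0 0), (0, 0) => //=; split; rewrite /= in_itv/= lexx ler01.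
by move=> _ [[c' t'] [/= c'01 t'01] <-]; apply: outer_objective_ge0.
Qed.

(* [t] and [Q] stand for [matched_time] and [displaced], [A] and [B] for the online and the offline
   gain, with [x] the rank of [v] and [b] the arrival time of [u]. *)
Section TwoDraws.
Variables (t : R -> R) (Q : R -> R -> Prop) (A B : R -> R -> R).
Hypothesis t_nd : forall x x', x <= x' -> t x <= t x'.
Hypothesis Q_nd : forall b x x', x <= x' -> Q b x -> Q b x'.
Hypothesis Q_ni : forall b b', b < b' -> Q b' 1 -> Q b 1.
Hypothesis A0 : forall x b, 0 <= A x b.
Hypothesis B0 : forall x b, 0 <= B x b.
Hypothesis mA : measurable_fun setT (fun p : R * R => A p.1 p.2).
Hypothesis mB : measurable_fun setT (fun p : R * R => B p.1 p.2).
Hypothesis B_time : forall x b, t x <= 1 -> g x (t x) <= B x b.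
Hypothesis B_notQ : forall x b, ~ Q b x -> g x b <= B x b.
Hypothesis A_Q : forall x x0 b, Q b x0 -> 1 - g x0 b <= A x b.
Hypothesis AB_1 : forall x b, ~ Q b x -> b < t x -> 1 <= A x b + B x b.

(** The added points 0 here and 1 in [tau] keep the sets nonempty and are the intended values when
    the first sets are empty. *)
Let gamma := sup ([set x | 0 <= x <= 1 /\ t x <= 1] `|` [set 0]).
Let tau := inf ([set b | 0 <= b <= 1 /\ ~ Q b 1] `|` [set 1]).
Let theta b := inf [set x | 0 <= x <= 1 /\ Q b x].
(** [T x] is [t x] truncated to [[tau, 1]]. When [t x <= 1], [D x] is the positive part of
    [g x tau - g x (t x)]. *)
Let T x := Num.min 1 (Num.max (t x) tau).
Let D x := g x tau - g x (T x).

Let gamma_sup : has_sup ([set x | 0 <= x <= 1 /\ t x <= 1] `|` [set 0]).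
Proof.
split; first by exists 0; right.
by exists 1 => x [[/andP[]]|->].
Qed.

Let tau_inf : has_inf ([set b | 0 <= b <= 1 /\ ~ Q b 1] `|` [set 1]).
Proof.
split; first by exists 1; right.
by exists 0 => x [[/andP[]]|->].
Qed.

Let gamma01 : 0 <= gamma <= 1.
Proof.
apply/andP; split; first by apply: sup_upper_bound => //; right.
by apply: ge_sup; [exists 0; right|move=> x [[/andP[]]|->]].
Qed.

Let tau01 : 0 <= tau <= 1.
Proof.
apply/andP; split; last by apply: ge_inf; [case: tau_inf|right].
by apply: lb_le_inf; [exists 1; right|move=> x [[/andP[]]|->]].
Qed.

Let lt_gamma x : x < gamma -> 0 <= x -> t x <= 1.
Proof.
move=> xg x0; have [s [[_ ts]|->] xs] := sup_gt gamma_sup.1 xg.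
  exact: le_trans (t_nd (ltW xs)) ts.
by move: xs; rewrite ltNge x0.
Qed.

Let gt_gamma x : gamma < x -> x <= 1 -> 1 < t x.
Proof.
move=> gx x1; rewrite ltNge; apply/negP => tx.
have /andP[g0 _] := gamma01.
have : x <= gamma by apply: sup_upper_bound => //; left; split=> //; rewrite x1 andbT; lra.
by lra.
Qed.

Let lt_tau b : 0 <= b -> b < tau -> Q b 1.
Proof.
move=> b0 bt; apply: contrapT => nQ; have /andP[_ t1] := tau01.
have : tau <= b.
  apply: ge_inf; first by case: tau_inf.
  by left; split=> //; rewrite b0; lra.
by lra.
Qed.

Let gt_tau b x : tau < b -> b <= 1 -> x <= 1 -> ~ Q b x.
Proof.
move=> tb b1 x1 /(Q_nd x1) Qb.
have [s [[_ ns]|->] sb] := inf_lt tau_inf.1 tb; first by apply: ns; exact: Q_ni Qb.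
by lra.
Qed.

Let T_bounds x : tau <= T x <= 1.
Proof.
have /andP[_ t1] := tau01.
by rewrite /T le_min ge_min lexx t1 le_max lexx orbT.
Qed.

Let T_time x : t x <= 1 -> t x <= T x.
Proof. by move=> tx; rewrite /T le_min tx le_max lexx. Qed.

Let T_nd x x' : x <= x' -> T x <= T x'.
Proof.
move=> xx'; rewrite /T le_min ge_min lexx /= ge_min ge_max !le_max lexx t_nd//=.
by rewrite !orbT.
Qed.

Let D01 x : 0 <= D x <= 1.
Proof.
have /andP[Tt _] := T_bounds x; have := g_niy x Tt.
by have := g01 x tau; have := g01 x (T x); rewrite /D; lra.
Qed.

Let mT : measurable_fun setT T.
Proof. exact: nondecreasing_measurable. Qed.

Let mD : measurable_fun setT (fun x => (D x)%:E).
Proof.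
apply/measurable_EFinP; apply: measurable_funB; first exact: mg.
apply: (@measurableT_comp _ _ _ _ _ _ (fun p : R * R => g p.1 p.2) _ (fun x => (x, T x))).
  exact: continuous_monotone_measurable_fun.
by apply: measurable_fun_pair.
Qed.

Let mF : measurable_fun setT (fun p : R * R => (A p.1 p.2 + B p.1 p.2)%:E).
Proof. by apply/measurable_EFinP; exact: measurable_funD. Qed.

Let mAx b : measurable_fun setT (fun x => (A x b)%:E).
Proof. by apply/measurable_EFinP; exact: (measurable_fun_pair1 b mA). Qed.

Let mBx b : measurable_fun setT (fun x => (B x b)%:E).
Proof. by apply/measurable_EFinP; exact: (measurable_fun_pair1 b mB). Qed.

Let F0 p : (0 <= (A p.1 p.2 + B p.1 p.2)%:E)%E.
Proof. by rewrite lee_fin addr_ge0. Qed.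

(* Bounds what each time [b < tau] falls short by; the times [b > tau] repay [tau * loss]. *)
Let loss : \bar R := (\int[mu]_(x in `[0%R, gamma[) (D x)%:E)%E.

Let loss_ge0 : (0 <= loss)%E.
Proof. by apply: integral_ge0 => x _; rewrite lee_fin; case/andP: (D01 x). Qed.

Let loss_fin : loss \is a fin_num.
Proof.
rewrite ge0_fin_numE//; apply: (@le_lt_trans _ _ (\int[mu]_(x in `[0%R, gamma[) (cst 1 x))%E).
  apply: ge0_le_integral => //= [x _||x _].
  - by rewrite lee_fin; case/andP: (D01 x).
  - exact: measurable_funTS.
  - by rewrite lee_fin; case/andP: (D01 x).
rewrite integral_cst//= mul1e lebesgue_measure_itv/= lte_fin.
by case: ifP => // _; rewrite -EFinD ltry.
Qed.

(** [Q b] may fail at the infimum [theta b] itself, so [A_Q] is applied at points just above it and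
    continuity does the rest. *)
Let theta_A x b : Q b 1 -> 1 - g (theta b) b <= A x b.
Proof.
move=> Qb; rewrite leNgt; apply/negP => lt.
have hi : [set x | 0 <= x <= 1 /\ Q b x] !=set0 by exists 1; rewrite /= ler01 lexx.
have e0 : 0 < 1 - A x b - g (theta b) b by lra.
have /cvgrPdist_lt/(_ _ e0) : g s b @[s --> theta b] --> g (theta b) b.
  exact: continuous_section1.
move=> /nbhs_ballP[d /= d0 dV].
have [|s [s01 Qs] sd] := @inf_lt _ _ (theta b + d) hi; first by rewrite -/(theta b) ltrDl.
have ths : theta b <= s.
  by apply: ge_inf => //; exists 0 => y [/andP[]].
have := dV s; rewrite /ball/= ltr_norml => /(_ _)/wrap[|].
  by apply/andP; split; lra.
by have := A_Q x Qs; rewrite ltr_norml => ? /andP[]; lra.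
Qed.

Let lt_theta x b : 0 <= x <= 1 -> x < theta b -> ~ Q b x.
Proof.
move=> x01 xt Qx; have : theta b <= x by apply: ge_inf => //; exists 0 => y [/andP[]].
by lra.
Qed.

Let theta01 b : Q b 1 -> 0 <= theta b <= 1.
Proof.
move=> Qb; apply/andP; split.
  by apply: lb_le_inf; [exists 1; rewrite /= ler01 lexx|move=> x [/andP[]]].
by apply: ge_inf; [exists 0 => y [/andP[]]|rewrite /= ler01 lexx].
Qed.

Local Ltac mfun :=
  first [exact: mAx | exact: mBx | exact: mD | exact: mgx | assumption | exact: measurable_cst].

Let early b : 0 <= b -> b < tau ->
  ((inner_min g gamma tau b)%:E <=
   \int[mu]_(x in `[0%R, 1%R]) (A x b + B x b)%:E + loss)%E.
Proof.
move=> b0 bt; have Qb := lt_tau b0 bt; have /andP[th0 th1] := theta01 Qb.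
have /andP[g0 g1] := gamma01; have /andP[t0 t1] := tau01.
have -> : (\int[mu]_(x in `[0%R, 1%R]) (A x b + B x b)%:E =
  \int[mu]_(x in `[0%R, 1%R]) ((A x b)%:E + (B x b)%:E))%E by [].
rewrite ge0_integralD//; last 4 first.
- by move=> x _; rewrite lee_fin.
- by apply: measurable_funTS; mfun.
- by move=> x _; rewrite lee_fin.
- by apply: measurable_funTS; mfun.
have hA : ((1 - g (theta b) b)%:E <= \int[mu]_(x in `[0%R, 1%R]) (A x b)%:E)%E.
  apply: (@le_trans _ _ (\int[mu]_(x in `[0%R, 1%R]) (cst (1 - g (theta b) b)%:E x))%E).
    rewrite integral_cst//= lebesgue_measure_itv/= lte_fin ltr01 -EFinD subr0.
    by rewrite mule1.
  apply: ge0_le_integral => //= [x _||x _].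
  - by rewrite lee_fin subr_ge0; case/andP: (g01 (theta b) b).
  - by apply: measurable_funTS; mfun.
  - by rewrite lee_fin; exact: theta_A.
have hB : (\int[mu]_(x in `[0%R, theta b[) (g x b)%:E <=
    \int[mu]_(x in `[0%R, theta b[) (B x b)%:E)%E.
  apply: ge0_le_integral => //=.
  - by move=> x _; rewrite lee_fin; case/andP: (g01 x b).
  - by apply: measurable_funTS; mfun.
  - by apply: measurable_funTS; mfun.
  - move=> x; rewrite in_itv/= => /andP[x0 xt]; rewrite lee_fin; apply: B_notQ.
    by apply: lt_theta => //; rewrite x0; lra.
have [tg|gt] := leP (theta b) gamma.
  apply: (@le_trans _ _ (inner_objective g gamma tau b (theta b))%:E).
    by rewrite lee_fin inner_min_le// th0.
  rewrite inner_objectiveE// -addeA; apply: leeD => //.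
  (* Below [gamma] the offline gain is at least [g x (t x)], hence at least
     [g x (T x) = g x tau - D x]. *)
  have hB2 : (\int[mu]_(x in `]theta b, gamma[) (g x tau)%:E <=
      \int[mu]_(x in `]theta b, gamma[) (B x b)%:E + loss)%E.
    apply: (@le_trans _ _ (\int[mu]_(x in `]theta b, gamma[) ((B x b)%:E + (D x)%:E))%E).
      apply: ge0_le_integral => //=.
      - by move=> x _; rewrite lee_fin; case/andP: (g01 x tau).
      - by apply: measurable_funTS; mfun.
      - by apply: emeasurable_funD; by apply: measurable_funTS; mfun.
      - move=> x; rewrite in_itv/= => /andP[tx xg]; rewrite -EFinD lee_fin /D.
        have tx1 : t x <= 1 by apply: lt_gamma => //; lra.
        have := B_time b tx1; have := g_niy x (T_time tx1); lra.
    rewrite ge0_integralD//; last 4 first.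
    - by move=> x _; rewrite lee_fin.
    - by apply: measurable_funTS; mfun.
    - by move=> x _; rewrite lee_fin; case/andP: (D01 x).
    - by apply: measurable_funTS; mfun.
    apply: leeD => //; apply: ge0_subset_integral => //=.
    - by apply: measurable_funTS; mfun.
    - by move=> x _; rewrite lee_fin; case/andP: (D01 x).
    - by move=> x /=; rewrite !in_itv/= => /andP[tx ->]; rewrite andbT; lra.
  apply: le_trans (leeD hB hB2) _; rewrite addeA; apply: leeD => //.
  apply: ge0_disjoint_integral_le => //=.
  - exact: mBx.
  - by move=> x; rewrite lee_fin.
  - by move=> x /=; rewrite !in_itv/= => /andP[-> ?]; lra.
  - by move=> x /=; rewrite !in_itv/= => /andP[? ?]; lra.
  - by apply/seteqP; split=> // x /= []; rewrite !in_itv/=; lra.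
(* A threshold beyond [gamma] is compared with the parameter [gamma]: the drop from [1 - g gamma b]
   to [1 - g (theta b) b] is at most the integral of [g] between them, by [g_growth]. *)
apply: (@le_trans _ _ (inner_objective g gamma tau b gamma)%:E).
  by rewrite lee_fin inner_min_le// g0 lexx.
apply: (@le_trans _ _ ((1 - g (theta b) b)%:E +
    \int[mu]_(x in `[0%R, theta b[) (g x b)%:E)%E); last first.
  apply: (@le_trans _ _ (\int[mu]_(x in `[0%R, 1%R]) (A x b)%:E +
    \int[mu]_(x in `[0%R, 1%R]) (B x b)%:E)%E); last by rewrite leeDl.
  apply: leeD => //; apply: le_trans hB _; apply: ge0_subset_integral => //=.
  - by apply: measurable_funTS; mfun.
  - by move=> x _; rewrite lee_fin.
  - by move=> x /=; rewrite !in_itv/= => /andP[-> ?]; lra.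
rewrite integral_itv_bndo_bndc; last by apply: measurable_funTS; mfun.
rewrite -RintE -EFinD lee_fin /inner_objective -/mu.
rewrite (@Rintegral_itv_addl _ (g ^~ b) 0 gamma (theta b))//; [|exact: continuous_section1|exact: ltW].
rewrite set_itv1 Rintegral_set1.
have := @g_growth b gamma (theta b); rewrite b0 /=; lra.
Qed.

(** After [tau] nothing is displaced. For [x > gamma] one has [t x > 1], so the gain is 1
    throughout. For [x < gamma] it is at least 1 up to [T x] and at least [g x (T x)] from then
    on. *)
Let late : (((1 - tau) * (1 - gamma))%:E
    + (1 - tau)%:E * \int[mu]_(x in `[0%R, gamma[) (g x tau)%:E + tau%:E * loss <=
  \int[mu]_(x in `[0%R, 1%R]) \int[mu]_(b in `]tau, 1%R]) (A x b + B x b)%:E)%E.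
Proof.
have /andP[g0 g1] := gamma01; have /andP[t0 t1] := tau01.
pose H x := (\int[mu]_(b in `]tau, 1%R]) (A x b + B x b)%:E)%E.
have mH : measurable_fun setT H.
  exact: (@measurable_integral_section1 _ _ _ _ _ mu _ (fun p : R * R => (A p.1 p.2 + B p.1 p.2)%:E)).
have H0 x : (0 <= H x)%E by apply: integral_ge0 => b _; rewrite lee_fin addr_ge0.
have mFx x : measurable_fun setT (fun b => (A x b + B x b)%:E).
  exact: (measurable_fun_pair2 x mF).
have h1 : (((1 - tau) * (1 - gamma))%:E <= \int[mu]_(x in `]gamma, 1%R]) H x)%E.
  apply: (@le_trans _ _ (\int[mu]_(x in `]gamma, 1%R]) (cst (1 - tau)%:E x))%E).
    rewrite integral_cst//= lebesgue_measure_itv/= lte_fin EFinM.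
    case: ltP => h; first exact: lexx.
    by rewrite (_ : gamma = 1) ?subrr//; lra.
  apply: ge0_le_integral => //=.
  - by move=> x _; rewrite lee_fin subr_ge0.
  - by apply: measurable_funTS; mfun.
  - move=> x; rewrite in_itv/= => /andP[gx x1].
    apply: (@le_trans _ _ (\int[mu]_(b in `]tau, 1%R]) (cst 1%:E b))%E).
      rewrite integral_cst//= lebesgue_measure_itv/= lte_fin mul1e.
      case: ltP => h; first exact: lexx.
      by rewrite lee_fin; lra.
    apply: ge0_le_integral => //=; first by apply: measurable_funTS; exact: mFx.
    move=> b; rewrite in_itv/= => /andP[tb b1]; rewrite lee_fin.
    apply: AB_1; first exact: gt_tau.
    by have := gt_gamma gx x1; lra.
have h2 : ((1 - tau)%:E * \int[mu]_(x in `[0%R, gamma[) (g x tau)%:E + tau%:E * loss <=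
    \int[mu]_(x in `[0%R, gamma[) H x)%E.
  rewrite -ge0_integralZl//; last 3 first.
  - by apply: measurable_funTS; mfun.
  - by move=> x _; rewrite lee_fin; case/andP: (g01 x tau).
  - by rewrite lee_fin subr_ge0.
  rewrite -ge0_integralZl//; last 2 first.
  - by apply: measurable_funTS; mfun.
  - by move=> x _; rewrite lee_fin; case/andP: (D01 x).
  rewrite -ge0_integralD//=; last 4 first.
  - by move=> x _; rewrite -EFinM lee_fin mulr_ge0 ?subr_ge0//; case/andP: (g01 x tau).
  - by apply: measurable_funeM; by apply: measurable_funTS; mfun.
  - by move=> x _; rewrite -EFinM lee_fin mulr_ge0//; case/andP: (D01 x).
  - by apply: measurable_funeM; by apply: measurable_funTS; mfun.
  apply: ge0_le_integral => //=.
  - move=> x _; rewrite -!EFinM -EFinD lee_fin addr_ge0// mulr_ge0// ?subr_ge0//.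
      by case/andP: (g01 x tau).
    by apply: g_niy; case/andP: (T_bounds x).
  - by apply: emeasurable_funD; apply: measurable_funeM; by apply: measurable_funTS; mfun.
  - by apply: measurable_funTS; mfun.
  - move=> x; rewrite in_itv/= => /andP[x0 xg]; rewrite -!EFinM -EFinD.
    have /andP[tT T1] := T_bounds x.
    have tx1 := lt_gamma xg x0.
    have x1 : x <= 1 by lra.
    apply: (@le_trans _ _ (\int[mu]_(b in `]tau, T x[) (cst 1%:E b) +
        \int[mu]_(b in `]T x, 1%R]) (cst (g x (T x))%:E b))%E).
      rewrite !integral_cst//= !lebesgue_measure_itv/= !lte_fin mul1e.
      (* The required [(1 - tau) * g x tau + tau * D x <= (T x - tau) + (1 - T x) * g x (T x)] is a
         rearrangement of [g_decay] between [tau] and [T x]. *)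
      have := @g_decay x tau (T x); rewrite x0 x1 => /(_ erefl t0 tT T1) dec.
      rewrite (_ : (if tau < T x then _ else _) = (T x - tau)%:E); last first.
        by case: ltP => h; rewrite -?EFinD//; congr EFin; lra.
      rewrite (_ : (if T x < 1 then _ else _) = (1 - T x)%:E); last first.
        by case: ltP => h; rewrite -?EFinD//; congr EFin; lra.
      by rewrite -EFinM -EFinD lee_fin /D; lra.
    apply: (@le_trans _ _ (\int[mu]_(b in `]tau, T x[) (A x b + B x b)%:E +
        \int[mu]_(b in `]T x, 1%R]) (A x b + B x b)%:E)%E).
      apply: leeD; apply: ge0_le_integral => //=.
      + by apply: measurable_funTS; exact: mFx.
      + move=> b; rewrite in_itv/= => /andP[tb bT]; rewrite lee_fin; apply: AB_1.
          by apply: gt_tau => //; lra.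
        move: bT; rewrite /T lt_min => /andP[_]; rewrite lt_max => /orP[//|]; lra.
      + by move=> b _; rewrite lee_fin; case/andP: (g01 x (T x)).
      + by apply: measurable_funTS; exact: mFx.
      + move=> b; rewrite in_itv/= => /andP[Tb b1]; rewrite lee_fin.
        have := B_time b tx1; have := g_niy x (T_time tx1); have := A0 x b; lra.
    apply: ge0_disjoint_integral_le => //=.
    + exact: mFx.
    + by move=> b; rewrite lee_fin addr_ge0.
    + by move=> b /=; rewrite !in_itv/=; lra.
    + by move=> b /=; rewrite !in_itv/=; lra.
    + by apply/seteqP; split=> // b /= []; rewrite !in_itv/=; lra.
rewrite -addeA; apply: le_trans (leeD h1 h2) _; rewrite addeC.
apply: ge0_disjoint_integral_le => //=.
- by move=> x /=; rewrite !in_itv/=; lra.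
- by move=> x /=; rewrite !in_itv/=; lra.
- by apply/seteqP; split=> // x /= []; rewrite !in_itv/=; lra.
Qed.

Lemma ranking_bound_le_integral :
  ((ranking_bound g)%:E <=
   \int[mu]_(b in `[0%R, 1%R]) \int[mu]_(x in `[0%R, 1%R]) (A x b + B x b)%:E)%E.
Proof.
have /andP[t0 t1] := tau01; have /andP[g0 g1] := gamma01.
apply: (@le_trans _ _ (outer_objective g gamma tau)%:E).
  by rewrite lee_fin; exact: ranking_bound_le.
pose G b := (\int[mu]_(x in `[0%R, 1%R]) (A x b + B x b)%:E)%E.
have mG : measurable_fun setT G.
  exact: (@measurable_integral_section2 _ _ _ _ _ mu _ (fun p : R * R => (A p.1 p.2 + B p.1 p.2)%:E)).
have G0 b : (0 <= G b)%E by apply: integral_ge0 => x _; rewrite lee_fin addr_ge0.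
have tloss : (tau%:E * loss)%E \is a fin_num by rewrite fin_numM.
rewrite -(leeD2rE _ _ tloss).
have h1 : ((\int[mu]_(y in `[0%R, tau]) inner_min g gamma tau y)%:E <=
    \int[mu]_(b in `[0%R, tau[) G b + tau%:E * loss)%E.
  apply: le_trans (fine_le_self _) _.
    by apply: integral_ge0 => y _; rewrite lee_fin inner_min_ge0.
  (* [early] says nothing at [b = tau], so the majorant is infinite there; the point is null and
     drops out afterwards. *)
  pose h b := if b < tau then (G b + loss)%E else +oo%E.
  apply: (@le_trans _ _ (\int[mu]_(b in `[0%R, tau]) h b)%E).
    apply: ge0_le_integral_nonmeasurable => b /=; first by rewrite lee_fin inner_min_ge0.
    rewrite in_itv/= /h => /andP[b0 bt]; case: ifPn => [bt'|_]; last by rewrite leey.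
    exact: early.
  have hE b : `[0, tau[%classic b -> h b = (G b + loss)%E.
    by rewrite /= in_itv/= /h => /andP[_ ->].
  rewrite -integral_itv_bndo_bndc; last first.
    apply: (@eq_measurable_fun _ _ _ _ _ (fun b => (G b + loss)%E)).
      by move=> b; rewrite inE => /hE ->.
    by apply: emeasurable_funD => //; by apply: measurable_funTS; mfun.
  have -> : (\int[mu]_(b in `[0%R, tau[) h b = \int[mu]_(b in `[0%R, tau[) (G b + cst loss b))%E.
    by apply: eq_integral => b; rewrite inE => /hE ->.
  rewrite ge0_integralD//=; last by apply: measurable_funTS; mfun.
  rewrite integral_cst//= lebesgue_measure_itv/= lte_fin.
  rewrite leeD2l// muleC; case: ltP => h'; first by rewrite -EFinD subr0.
  by rewrite mul0e mule_ge0.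
have h2 := late.
have h3 : ((1 - tau)%:E * \int[mu]_(x in `[0%R, gamma[) (g x tau)%:E =
    ((1 - tau) * \int[mu]_(x in `[0, gamma]) g x tau)%:E)%E.
  by rewrite EFinM RintE integral_itv_bndo_bndc//; by apply: measurable_funTS; mfun.
rewrite /outer_objective -/mu !EFinD -h3.
rewrite [X in (X <= _)%E]addeAC; apply: le_trans (leeD h2 h1) _.
have m01 : measurable (`[0, 1]%classic : set R) by exact: measurable_itv.
have mt1 : measurable (`]tau, 1]%classic : set R) by exact: measurable_itv.
have fub := fubini_tonelli_sets mu mu m01 mt1 mF F0.
rewrite addeA; apply: leeD; last exact: lexx.
rewrite [X in (X + _ <= _)%E]fub addeC; apply: (@ge0_disjoint_integral_le _ _ _ mu _ _ _ G) => //=.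
- by move=> x /=; rewrite !in_itv/=; lra.
- by move=> x /=; rewrite !in_itv/=; lra.
- by apply/seteqP; split=> // x /= []; rewrite !in_itv/=; lra.
Qed.

End TwoDraws.
End Bound.

(** * Resampling two coordinates *)

(* Function types carry no measurable structure; this alias supports the product sigma-algebra. *)
Definition draws (I : Type) (R : realType) := I -> R.

HB.instance Definition _ I R := gen_eqMixin (draws I R).
HB.instance Definition _ I R := gen_choiceMixin (draws I R).
HB.instance Definition _ I R := isPointed.Build (draws I R) (fun=> 0).

Definition cylinder (I : Type) (R : realType) (B : I -> set R) : set (draws I R) :=
  [set y | forall i, B i (y i)].

Definition cylinders (I : Type) (R : realType) : set (set (draws I R)) :=
  [set cylinder B | B in [set B : I -> set R | forall i, measurable (B i)]].

Section ProductSpace.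
Variables (I : finType) (R : realType).
Local Notation Dr := (g_sigma_algebraType (@cylinders I R)).

Lemma cylinders_setI : setI_closed (@cylinders I R).
Proof.
move=> _ _ [B mB <-] [C mC <-]; exists (fun i => B i `&` C i).
  by move=> i; exact: measurableI.
by apply/seteqP; split=> [y h|y [h1 h2] i]; [split=> i; case: (h i)|split].
Qed.

Lemma cylinders_setT : @cylinders I R setT.
Proof. by exists (fun=> setT) => //; apply/seteqP; split. Qed.

Lemma measurable_draw i : measurable_fun setT (fun y : Dr => y i : R).
Proof.
move=> _ B mB; rewrite setTI; apply: sub_sigma_algebra.
exists (fun j => if j == i then B else setT) => [j|]; first by case: ifP.
apply/seteqP; split=> [y /(_ i)|y By j] /=; first by rewrite eqxx.
by case: eqP => // ->.
Qed.

Lemma measurable_into_draws d (X : measurableType d) (phi : X -> Dr) :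
  (forall i, measurable_fun setT (fun x => phi x i : R)) -> measurable_fun setT phi.
Proof.
move=> mphi; apply: (@measurability _ _ _ Dr _ _ (@cylinders I R) erefl) => // _ [_ [B mB <-] <-].
rewrite setTI (_ : _ @^-1` _ = \bigcap_(i in [set: I]) ((fun x => phi x i : R) @^-1` B i)).
  apply: fin_bigcap_measurable => [|i _]; first exact: finite_finset.
  by rewrite -[X in measurable X]setTI; exact: mphi.
by apply/seteqP; split=> [x h i _|x h i]; [exact: h|exact: h].
Qed.

(** Cylinders form a generating pi-system that contains the whole space. *)
Lemma eq_measure_draws (m1 m2 : {measure set Dr -> \bar R}) :
  (m1 setT < +oo)%E ->
  (forall B : I -> set R, (forall i, measurable (B i)) -> m1 (cylinder B) = m2 (cylinder B)) ->
  forall A, measurable A -> m1 A = m2 A.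
Proof.
move=> m1T m12; apply: (@measure_unique _ R Dr (@cylinders I R) (fun=> setT) erefl) => //.
- exact: cylinders_setI.
- by move=> _; exact: cylinders_setT.
- exact: bigcup_const.
- by move=> _ [B mB <-]; exact: m12.
Qed.

End ProductSpace.

Definition update (I : eqType) (R : realType) (y : draws I R) (i : I) (a : R) : draws I R :=
  fun j => if j == i then a else y j.

Section Resampling.
Context d (T : measurableType d) (R : realType) (P : probability T R).
Variables (I : finType) (Y : I -> {RV P >-> R}).
Hypothesis iidY : iid_uniform01 Y.
Local Notation Dr := (g_sigma_algebraType (@cylinders I R)).
Local Notation lam := (uniform_prob (@ltr01 R)).
Local Notation RR := (measurableTypeR R).

Lemma measurable_update i :
  measurable_fun setT (fun p : Dr * RR => update p.1 i p.2 : Dr).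
Proof.
apply: measurable_into_draws => j; rewrite /update.
case: (j == i); first exact: measurable_snd.
exact: (measurableT_comp (measurable_draw j) measurable_fst).
Qed.

Let joint t : Dr := Y ^~ t.

Let mjoint : measurable_fun setT joint.
Proof. by apply: measurable_into_draws => i; exact: measurable_funPT. Qed.

Let resampled i (p : T * RR) : Dr := update (joint p.1) i p.2.

Let mresampled i : measurable_fun setT (resampled i).
Proof.
apply: (@measurableT_comp _ _ _ _ _ _ (fun p : Dr * RR => update p.1 i p.2 : Dr) _
  (fun p : T * RR => (joint p.1, p.2))); first exact: measurable_update.
apply: measurable_fun_pair; last exact: measurable_snd.
exact: measurableT_comp mjoint measurable_fst.
Qed.

(** Both sides integrate [F] against laws on the space of draws. These agree on cylinders, because
    independence splits off the factor of coordinate [i], which is uniform. *)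
Lemma resample i (F : Dr -> \bar R) : measurable_fun setT F -> (forall y, 0 <= F y)%E ->
  (\int[P]_t F (joint t) = \int[P]_t \int[lam]_a F (update (joint t) i a))%E.
Proof.
move=> mF F0; have [Y01 Yu Yind] := iidY.
pose phi1 : {mfun T >-> Dr} := HB.pack joint (isMeasurableFun.Build _ _ _ _ _ mjoint).
pose phi2 : {mfun (T * RR)%type >-> Dr} :=
  HB.pack (resampled i) (isMeasurableFun.Build _ _ _ _ _ (mresampled i)).
transitivity (\int[pushforward P phi1]_y F y)%E.
  by rewrite ge0_integral_pushforward// => ? _; exact: F0.
transitivity (\int[pushforward (P \x lam)%E phi2]_y F y)%E; last first.
  rewrite ge0_integral_pushforward//=.
  rewrite preimage_setT (fubini_tonelli1 (m1 := P) (m2 := lam) (F \o resampled i))//=.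
  exact: measurableT_comp mF (mresampled i).
apply: eq_measure_integral => A mA _; apply: eq_measure_draws => //.
  by rewrite /= /pushforward preimage_setT probability_setT ltry.
move=> B mB; rewrite /= /pushforward.
rewrite (_ : phi1 @^-1` cylinder B =
    \bigcap_(j in [set` [set: I]%SET]) (Y j @^-1` B j)); last first.
  by apply/seteqP; split=> [t h j _|t h j]; [exact: h|apply: h => /=; rewrite inE].
rewrite (_ : phi2 @^-1` cylinder B =
    (\bigcap_(j in [set` (~: [set i])%SET]) (Y j @^-1` B j)) `*` B i); last first.
  apply/seteqP; split=> [[t a] h|[t a] [h1 h2] j] /=.
    split=> /= [j|]; last by have := h i; rewrite /= /resampled /update eqxx.
    by rewrite /= !inE => /negbTE ji; have := h j; rewrite /= /resampled /update ji.
  rewrite /resampled /update; case: eqVneq => [->//|ji].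
  by apply: h1; rewrite /= !inE.
rewrite product_measure1E; [|apply: fin_bigcap_measurable|exact: mB].
- rewrite !Yind// (bigD1 i) ?inE//= muleC; congr (_ * _)%E.
    by rewrite (Yind (~: [set i])%SET B mB); apply: eq_bigl => j; rewrite !inE.
  exact: (Yu i _ (mB i)).
- exact: finite_finset.
- by move=> j _; rewrite -[X in measurable X]setTI; exact: measurable_funPT.
Qed.

Lemma resample2 i j (F : Dr -> \bar R) : measurable_fun setT F -> (forall y, 0 <= F y)%E ->
  (\int[P]_t F (Y ^~ t) =
   \int[P]_t \int[lam]_b \int[lam]_a F (update (update (Y ^~ t) j b) i a))%E.
Proof.
move=> mF F0; rewrite (resample i mF F0).
apply: (@resample j (fun y => \int[lam]_a F (update y i a))%E) => [|y].
  apply: (measurable_fun_fubini_tonelli_F (m2 := lam) (fun p : Dr * RR => F (update p.1 i p.2))) => //.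
  exact: measurableT_comp mF (measurable_update i).
exact: integral_ge0.
Qed.

End Resampling.

(** * Measurability of the gains *)

Section GainMeasurable.
Variables (R : realType) (g : R -> R -> R).
Variables (U V : finType) (E : U -> V -> bool) (w : V -> R) (idV : V -> nat).
Hypothesis mg : measurable_fun setT (fun p : R * R => g p.1 p.2).
Local Notation Dr := (g_sigma_algebraType (@cylinders (U + V)%type R)).

(** The matching depends on [g] and the draws only through finitely many comparisons. This serves
    both for measurability and for replacing [g] by its extension. *)
Lemma ranking_matching_congr (g' : R -> R -> R) (y y' : U + V -> R) :
  (forall u v v', preferred g w idV y u v v' = preferred g' w idV y' u v v') ->
  (forall u u', (y (inl u) <= y (inl u')) = (y' (inl u) <= y' (inl u'))) ->
  ranking_matching g E w idV y = ranking_matching g' E w idV y'.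
Proof.
move=> hp ht; rewrite /ranking_matching /arrival_order.
have -> : (fun u u' => y (inl u) <= y (inl u')) = (fun u u' => y' (inl u) <= y' (inl u')).
  by apply/funext => u; apply/funext => u'.
have -> // : ranking_step g E w idV y = ranking_step g' E w idV y'.
apply/funext => M; apply/funext => u; rewrite /ranking_step.
have -> // : preferred g w idV y = preferred g' w idV y'.
by apply/funext => u1; apply/funext => v1; apply/funext => v2.
Qed.

Let comparison := (U * U + U * V * V)%type.

Let outcome (y : Dr) (k : comparison) : bool :=
  match k with
  | inl (u, u') => y (inl u) <= y (inl u')
  | inr (u, v, v') => preferred g w idV y u v v'
  end.

Let mterm u v : measurable_fun setT (fun y : Dr => g (y (inr v)) (y (inl u))).
Proof.
apply: (@measurableT_comp _ _ _ _ _ _ (fun p : R * R => g p.1 p.2) _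
  (fun y : Dr => (y (inr v), y (inl u)))) => //.
by apply: measurable_fun_pair; exact: measurable_draw.
Qed.

Let mscore u v : measurable_fun setT (fun y : Dr => score g w y u v).
Proof.
apply: measurable_funM; first exact: measurable_cst.
by apply: measurable_funB; [exact: measurable_cst|exact: mterm].
Qed.

Let moutcome k : measurable_fun setT (outcome ^~ k).
Proof.
case: k => [[u u']|[[u v] v']] /=.
  by apply: measurable_fun_ler; exact: measurable_draw.
rewrite /preferred; apply: measurable_or.
  by apply: measurable_fun_ltr; exact: mscore.
apply: measurable_and; last exact: measurable_cst.
by apply: measurable_fun_eqr; exact: mscore.
Qed.

Lemma measurable_mem_ranking e :
  measurable_fun setT (fun y : Dr => e \in ranking_matching g E w idV y).
Proof.
pose pattern (y : Dr) := [ffun k => outcome y k].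
apply: (measurable_fun_bool true); rewrite setTI.
(* The event is the finite union, over the comparison patterns that put [e] into the matching, of
   the sets of draws with that pattern. *)
rewrite (_ : _ @^-1` _ = \bigcup_(c in [set c | exists y : Dr, pattern y = c /\
    e \in ranking_matching g E w idV y]) [set y | pattern y = c]).
  apply: fin_bigcup_measurable => [|c _]; first exact: finite_finset.
  rewrite (_ : [set _ | _] = \bigcap_(k in [set: comparison]) (outcome ^~ k) @^-1` [set c k]).
    apply: fin_bigcap_measurable => [|k _]; first exact: finite_finset.
    by rewrite -[X in measurable X]setTI; exact: moutcome.
  apply/seteqP; split=> [y <- k _|y h] /=; first by rewrite ffunE.
  by apply/ffunP => k; rewrite ffunE; exact: h.
apply/seteqP; split=> [y ey|y [c [y' [<- ey']] yy']] /=.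
  by exists (pattern y) => //; exists y.
rewrite (@ranking_matching_congr g y y')// => [u v v'|u u'].
  by have /ffunP/(_ (inr (u, v, v'))) := yy'; rewrite !ffunE.
by have /ffunP/(_ (inl (u, u'))) := yy'; rewrite !ffunE.
Qed.

Lemma measurable_online_gain u :
  measurable_fun setT (fun y : Dr => online_gain g E w idV y u).
Proof.
rewrite /online_gain; under eq_fun do rewrite big_mkcond/=.
apply: measurable_sum => e; apply: measurable_fun_ifT.
- by apply: measurable_and; [exact: measurable_mem_ranking|exact: measurable_cst].
- apply: measurable_funM; first exact: measurable_cst.
  by apply: measurable_funB; [exact: measurable_cst|exact: mterm].
- exact: measurable_cst.
Qed.

Lemma measurable_offline_gain v :
  measurable_fun setT (fun y : Dr => offline_gain g E w idV y v).
Proof.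
rewrite /offline_gain; under eq_fun do rewrite big_mkcond/=.
apply: measurable_sum => e; apply: measurable_fun_ifT.
- by apply: measurable_and; [exact: measurable_mem_ranking|exact: measurable_cst].
- by apply: measurable_funM; [exact: measurable_cst|exact: mterm].
- exact: measurable_cst.
Qed.

End GainMeasurable.

(** * Extension to the plane and conclusion *)

Section Clamp.
Variable R : realType.
Implicit Types x y : R.

(** A monotone 1-Lipschitz retraction onto [0, 1]. Composing [g] with it in both arguments carries
    continuity and the order conditions over to the whole plane. *)
Definition clamp01 x : R := Num.max 0 (Num.min x 1).

Lemma clamp01_itv x : 0 <= clamp01 x <= 1.
Proof. by rewrite /clamp01 le_max lexx ge_max ler01 ge_min lexx orbT. Qed.

Lemma clamp01_id x : 0 <= x <= 1 -> clamp01 x = x.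
Proof. by move=> /andP[x0 x1]; rewrite /clamp01 min_l// max_r. Qed.

Lemma clamp01_le x y : x <= y -> clamp01 x <= clamp01 y.
Proof.
by rewrite /clamp01 /Num.max /Num.min; do ![case: ifPn]; rewrite -?leNgt; lra.
Qed.

Lemma clamp01_lip x y : `|clamp01 x - clamp01 y| <= `|x - y|.
Proof.
wlog xy : x y / y <= x => [h|].
  have [/h//|/ltW/h] := leP y x.
  by rewrite distrC [`|y - x|]distrC.
rewrite !ger0_norm ?subr_ge0//; last exact: clamp01_le.
by rewrite /clamp01 /Num.max /Num.min; do ![case: ifPn]; rewrite -?leNgt; lra.
Qed.

Lemma continuous_clamp01 (g : R -> R -> R) :
  {within `[0, 1] `*` `[0, 1], continuous (fun p : R * R => g p.1 p.2)} ->
  continuous (fun p : R * R => g (clamp01 p.1) (clamp01 p.2)).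
Proof.
move=> /subspace_continuousP cg [x y]; apply/cvgrPdist_lt => e e0.
have xy : (`[0, 1] `*` `[0, 1])%classic (clamp01 x, clamp01 y).
  by split; rewrite /= in_itv/= clamp01_itv.
have /cvgrPdist_lt/(_ e e0) := cg _ xy.
rewrite near_withinE => /nbhs_ballP[d /= d0 dV]; 
suff : nbhs ((x, y) : R * R) [set q | `|g (clamp01 x) (clamp01 y) -
    g (clamp01 q.1) (clamp01 q.2)| < e] by [].
apply/nbhs_ballP; exists d => //= -[x' y'] [/= bx b_y].
apply: (dV (clamp01 x', clamp01 y')); last by split; rewrite /= in_itv/= clamp01_itv.
by split; [move: bx|move: b_y]; rewrite /ball/=; apply: le_lt_trans; exact: clamp01_lip.
Qed.

End Clamp.

(** * Expected gain of an edge and the competitive ratio *)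

Section EdgeBound.
Variables (R : realType) (g : R -> R -> R).
Hypothesis g_cont : continuous (fun p : R * R => g p.1 p.2).
Hypothesis g01 : forall x b, 0 <= g x b <= 1.
Hypothesis g_ndx : forall x x' b, x <= x' -> g x b <= g x' b.
Hypothesis g_niy : forall x b b', b <= b' -> g x b' <= g x b.
Hypothesis g_diff : forall x b b', b <= b' -> g 1 b' - g x b' <= g 1 b - g x b.
Hypothesis g_growth : forall y a b, 0 <= y <= 1 -> 0 <= a -> a <= b -> b <= 1 ->
  g b y - g a y <= \int[lebesgue_measure]_(x in `[a, b]) g x y.
Hypothesis g_decay : forall x a b, 0 <= x <= 1 -> 0 <= a -> a <= b -> b <= 1 ->
  (1 + a - b) * (1 - g x b) <= 1 - g x a.
Variables (U V : finType) (E : U -> V -> bool) (w : V -> R) (idV : V -> nat).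
Hypothesis w0 : forall v, 0 <= w v.
Hypothesis idV_inj : injective idV.

Local Notation mu := (@lebesgue_measure R).
Local Notation Dr := (g_sigma_algebraType (@cylinders (U + V)%type R)).

Let edge_gain u v (y : U + V -> R) : R :=
  online_gain g E w idV y u + offline_gain g E w idV y v.

Let mg : measurable_fun setT (fun p : R * R => g p.1 p.2).
Proof. exact: (continuous_monotone_measurable_fun g_cont g_ndx g_niy). Qed.

Lemma measurable_edge_gain u v :
  measurable_fun setT (fun y : Dr => (edge_gain u v y)%:E).
Proof.
apply/measurable_EFinP; apply: measurable_funD.
- exact: measurable_online_gain mg _.
- exact: measurable_offline_gain mg _.
Qed.

Lemma edge_gain_ge0 u v y : 0 <= edge_gain u v y.
Proof. by rewrite addr_ge0 ?online_gain_ge0 ?offline_gain_ge0. Qed.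

Lemma measurable_redraw (z : U + V -> R) u v :
  measurable_fun setT (fun p : R * R => redraw z u v p.1 p.2 : Dr).
Proof.
apply: measurable_into_draws => -[u'|v'] /=.
- by case: (u' == u); [exact: measurable_snd|exact: measurable_cst].
- by case: (v' == v); [exact: measurable_fst|exact: measurable_cst].
Qed.

Lemma edge_gain_redraw z u v : E u v -> (forall v', z (inr v') <= 1) ->
  ((ranking_bound g * w v)%:E <=
   \int[mu]_(b in `[0%R, 1%R]) \int[mu]_(x in `[0%R, 1%R])
      (edge_gain u v (redraw z u v x b))%:E)%E.
Proof.
move=> Euv z1; have [wv|wv] := eqVneq (w v) 0.
  rewrite wv mulr0; apply: integral_ge0 => b _; apply: integral_ge0 => x _.
  by rewrite lee_fin edge_gain_ge0.
have wv0 : 0 < w v by rewrite lt_neqAle eq_sym wv w0.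
(* Dividing by [w v] normalises the weight of the edge to 1, as the bound for two draws expects. *)
pose A x b := online_gain g E w idV (redraw z u v x b) u / w v.
pose B x b := offline_gain g E w idV (redraw z u v x b) v / w v.
have divw (c r : R) : w v * c <= r -> c <= r / w v by rewrite ler_pdivlMr// mulrC.
have mA : measurable_fun setT (fun p : R * R => A p.1 p.2).
  apply: measurable_funM; last exact: measurable_cst.
  exact: (measurableT_comp (measurable_online_gain E w idV mg u) (measurable_redraw z u v)).
have mB : measurable_fun setT (fun p : R * R => B p.1 p.2).
  apply: measurable_funM; last exact: measurable_cst.
  exact: (measurableT_comp (measurable_offline_gain E w idV mg v) (measurable_redraw z u v)).
have A0 x b : 0 <= A x b by rewrite divr_ge0 ?online_gain_ge0.
have B0 x b : 0 <= B x b by rewrite divr_ge0 ?offline_gain_ge0.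
have mAB : measurable_fun setT (fun p : R * R => (A p.1 p.2 + B p.1 p.2)%:E).
  by apply/measurable_EFinP; exact: measurable_funD.
have core := @ranking_bound_le_integral R g g_cont g01 g_ndx g_niy g_growth g_decay
  (matched_time g E w idV z u v) (displaced g E w idV z u v) A B
  (matched_time_nd E g_ndx w0 idV_inj z u v)
  (displaced_nd g_ndx w0 idV_inj (z := z) (u := u) (v := v)).
have {core}core : ((ranking_bound g)%:E <=
    \int[mu]_(b in `[0%R, 1%R]) \int[mu]_(x in `[0%R, 1%R]) (A x b + B x b)%:E)%E.
  apply: core => //.
  - exact: displaced_ni.
  - by move=> x b tx; apply: divw; exact: offline_gain_matched_time.
  - by move=> x b nd; apply: divw; exact: offline_gain_not_displaced.
  - by move=> x x0 b nd; apply: divw; exact: online_gain_displaced nd.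
  - move=> x b nd bt; rewrite /A /B -mulrDl; apply: divw; rewrite mulr1.
    exact: gain_not_displaced.
rewrite mulrC EFinM.
apply: (@le_trans _ _ ((w v)%:E * \int[mu]_(b in `[0%R, 1%R])
    \int[mu]_(x in `[0%R, 1%R]) (A x b + B x b)%:E)%E).
  by rewrite lee_pmul2l// lte_fin.
have m01 : measurable (`[0, 1]%classic : set R) by exact: measurable_itv.
have AB0 p : (0 <= (A p.1 p.2 + B p.1 p.2)%:E)%E by rewrite lee_fin addr_ge0.
rewrite -ge0_integralZl; last 4 first.
- exact: m01.
- by apply: measurable_funTS; exact: (measurable_integral_section2 mu m01 mAB AB0).
- by move=> b _; apply: integral_ge0 => x _; exact: (AB0 (x, b)).
- by rewrite lee_fin.
apply: ge0_le_integral_nonmeasurable => b _.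
  apply: mule_ge0; first by rewrite lee_fin.
  by apply: integral_ge0 => x _; exact: (AB0 (x, b)).
rewrite -ge0_integralZl; last 4 first.
- exact: m01.
- by apply: measurable_funTS; exact: (measurable_fun_pair1 b mAB).
- by move=> x _; exact: (AB0 (x, b)).
- by rewrite lee_fin.
apply: ge0_le_integral_nonmeasurable => x _.
  by apply: mule_ge0; [rewrite lee_fin|exact: (AB0 (x, b))].
by rewrite -EFinM lee_fin /A /B -mulrDl mulrC divfK.
Qed.

Section Probability.
Context d (T : measurableType d) (P : probability T R).
Variable (Y : U + V -> {RV P >-> R}).
Hypothesis iidY : iid_uniform01 Y.

Lemma expected_edge_gain u v : E u v ->
  ((ranking_bound g * w v)%:E <= \int[P]_t (edge_gain u v (Y ^~ t))%:E)%E.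
Proof.
move=> Euv; have [Y01 _ _] := iidY.
(* Redrawing the rank of [v] and the arrival time of [u] keeps the expectation and reduces the claim
   to a bound for each fixed [t]. *)
rewrite (resample2 iidY (inr v) (inl u) (measurable_edge_gain u v)); last first.
  by move=> y; rewrite lee_fin edge_gain_ge0.
apply: (@le_trans _ _ (\int[P]_t (cst (ranking_bound g * w v)%:E t))%E).
  by rewrite integral_cst//= probability_setT mule1.
apply: ge0_le_integral_nonmeasurable => t _ /=.
  by rewrite lee_fin mulr_ge0// ranking_bound_ge0.
have z1 v' : Y (inr v') t <= 1 by case/andP: (Y01 (inr v') t).
apply: le_trans (edge_gain_redraw (z := Y ^~ t) Euv z1) _.
have mup : measurable_fun setT (fun p : R * R => (edge_gain u v (redraw (Y ^~ t) u v p.1 p.2))%:E).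
  exact: (measurableT_comp (measurable_edge_gain u v) (measurable_redraw (Y ^~ t) u v)).
have up0 (p : R * R) : (0 <= (edge_gain u v (redraw (Y ^~ t) u v p.1 p.2))%:E)%E.
  by rewrite lee_fin edge_gain_ge0.
have updE x b : update (update (Y ^~ t) (inl u) b) (inr v) x = redraw (Y ^~ t) u v x b.
  by apply/funext => -[u'|v'].
have m01 : measurable (`[0, 1]%classic : set R) by exact: measurable_itv.
have inner b : (\int[uniform_prob (@ltr01 R)]_a
      (edge_gain u v (update (update (Y ^~ t) (inl u) b) (inr v) a))%:E =
    \int[mu]_(x in `[0%R, 1%R]) (edge_gain u v (redraw (Y ^~ t) u v x b))%:E)%E.
  under eq_integral do rewrite updE.
  rewrite integral_uniform; last 2 first.
  - exact: (measurable_fun_pair1 b mup).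
  - by move=> x; exact: (up0 (x, b)).
  by rewrite subr0 invr1 mul1e.
under [X in (_ <= X)%E]eq_integral do rewrite inner.
rewrite integral_uniform; last 2 first.
- exact: (measurable_integral_section2 mu m01 mup up0).
- by move=> b; apply: integral_ge0 => x _; exact: (up0 (x, b)).
by rewrite subr0 invr1 mul1e.
Qed.

Lemma max_matching_weight_attained : max_matching_weight E w = 0 \/
  exists2 M, is_matching E M & max_matching_weight E w = matching_weight w M.
Proof.
rewrite /max_matching_weight.
apply: (big_ind (fun m => m = 0 \/ exists2 M, is_matching E M & m = matching_weight w M)).
- by left.
- by move=> a b ha hb; rewrite /Num.max; case: ifP.
- by move=> M hM; right; exists M.
Qed.

(** The weight obtained is the sum of all gains. As gains are nonnegative and each vertex lies on at
    most one edge of an optimal matching [M], it is at least the sum of [edge_gain] over [M]. *)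
Lemma expected_ranking_weight :
  ((ranking_bound g * max_matching_weight E w)%:E <=
   \int[P]_t (matching_weight w (ranking_matching g E w idV (Y ^~ t)))%:E)%E.
Proof.
have [->|[M Mm ->]] := max_matching_weight_attained.
  rewrite mulr0; apply: integral_ge0 => t _; rewrite lee_fin.
  by apply: sumr_ge0 => v _; exact: w0.
move: Mm => /andP[/forall_inP ME /forall_inP Mm].
have fst_inj : {in M &, injective (@fst U V)}.
  move=> e e' eM e'M ee'; apply/eqP; have /forall_inP/(_ e' e'M) := Mm e eM.
  by rewrite ee' eqxx.
have snd_inj : {in M &, injective (@snd U V)}.
  move=> e e' eM e'M ee'; apply/eqP; have /forall_inP/(_ e' e'M) := Mm e eM.
  by rewrite ee' eqxx orbT.
rewrite /matching_weight /matched_offline big_imset//= mulr_sumr -sumEFin.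
apply: (@le_trans _ _ (\int[P]_t (\sum_(e <- enum M) (edge_gain e.1 e.2 (Y ^~ t))%:E))%E).
  rewrite -big_enum/= ge0_integral_sum//.
  - rewrite [leLHS]big_seq [leRHS]big_seq; apply: lee_sum => e; rewrite mem_enum => eM.
    by apply: expected_edge_gain; exact: ME.
  - move=> e; apply: (@measurableT_comp _ _ _ _ _ _ (fun y : Dr => (edge_gain e.1 e.2 y)%:E) _
      (fun t => Y ^~ t : Dr)); first exact: measurable_edge_gain.
    by apply: measurable_into_draws => i; exact: measurable_funPT.
  - by move=> e t _; rewrite lee_fin edge_gain_ge0.
apply: ge0_le_integral_nonmeasurable => t _.
  by apply: sume_ge0 => e _; rewrite lee_fin edge_gain_ge0.
rewrite big_enum/= sumEFin lee_fin.
rewrite -[leRHS]/(matching_weight w (ranking_matching g E w idV (Y ^~ t))).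
rewrite -total_gain//.
rewrite /edge_gain big_split/=; apply: lerD.
- rewrite -(big_imset (fun u => online_gain g E w idV (Y ^~ t) u) fst_inj)/=.
  rewrite [leRHS](bigID (mem (fst @: M)%SET))/= lerDl.
  by apply: sumr_ge0 => u _; exact: online_gain_ge0.
- rewrite -(big_imset (fun v => offline_gain g E w idV (Y ^~ t) v) snd_inj)/=.
  rewrite [leRHS](bigID (mem (snd @: M)%SET))/= lerDl.
  by apply: sumr_ge0 => v _; exact: offline_gain_ge0.
Qed.

End Probability.
End EdgeBound.

(** * The bound depends only on the values of [g] in the unit square *)

Section BoundCongr.
Variables (R : realType) (g g' : R -> R -> R).
Hypothesis gg' : forall x y, 0 <= x <= 1 -> 0 <= y <= 1 -> g x y = g' x y.

Let integral_congr y c : 0 <= y <= 1 -> forall th, 0 <= th -> c <= 1 ->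
  \int[lebesgue_measure]_(x in `[th, c]) g x y =
  \int[lebesgue_measure]_(x in `[th, c]) g' x y.
Proof.
move=> y01 th th0 c1; apply: eq_Rintegral => x; rewrite inE/= in_itv/= => /andP[x0 xc].
by apply: gg' => //; lra.
Qed.

Let inner_min_congr c tau y : 0 <= c <= 1 -> 0 <= tau <= 1 -> 0 <= y <= 1 ->
  inner_min g c tau y = inner_min g' c tau y.
Proof.
move=> /andP[c0 c1] t01 y01; rewrite /inner_min.
apply: (congr1 inf (eq_imagel _)) => th; rewrite /= in_itv/= => /andP[th0 thc].
rewrite /inner_objective gg'//; last lra.
by rewrite !integral_congr//; lra.
Qed.

Lemma ranking_bound_congr : ranking_bound g = ranking_bound g'.
Proof.
suff e p : (`[0, 1] `*` `[0, 1])%classic p ->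
    outer_objective g p.1 p.2 = outer_objective g' p.1 p.2.
  exact: (congr1 inf (eq_imagel e)).
move=> [c01 t01]; move: c01 t01.
rewrite /= !in_itv/= => c01 t01; have c1 : p.1 <= 1 by case/andP: c01.
rewrite /outer_objective; apply: (f_equal2 +%R).
  by apply: (f_equal2 +%R) => //; rewrite integral_congr.
by apply: eq_Rintegral => y; rewrite inE/= in_itv/= => /andP[y0 yt];
  apply: inner_min_congr => //; lra.
Qed.

End BoundCongr.

Theorem theorem1 (R : realType) (g : R -> R -> R)
  (g01 : forall x y, 0 <= x <= 1 -> 0 <= y <= 1 -> 0 <= g x y <= 1)
  (g_cont : {within `[0, 1] `*` `[0, 1],
               continuous (fun p : R * R => g p.1 p.2)})
  (g_ndx : forall x x' y, 0 <= x <= 1 -> 0 <= x' <= 1 -> 0 <= y <= 1 ->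
     x <= x' -> g x y <= g x' y)
  (g_niy : forall x y y', 0 <= x <= 1 -> 0 <= y <= 1 -> 0 <= y' <= 1 ->
     y <= y' -> g x y' <= g x y)
  (g_dx : forall y, 0 <= y <= 1 ->
     deriv_le01 (fun x => g x y) (fun x => g x y))
  (g_dy : forall x, 0 <= x <= 1 ->
     deriv_ge01 (fun y => g x y) (fun y => g x y - 1))
  (g_diff : forall x y y', 0 <= x <= 1 -> 0 <= y <= 1 -> 0 <= y' <= 1 ->
     y < y' -> g 1 y' - g x y' <= g 1 y - g x y) :
  ranking_competitive_ratio_ge g (ranking_bound g).
Proof.
move=> U V E w idV w0 idV_inj d T P Y iidY.
(* The earlier lemmas ask for their order and continuity conditions on the whole plane, so they are
   applied to this extension of [g]. *)
pose gc x y := g (clamp01 x) (clamp01 y).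
have ggc x y : 0 <= x <= 1 -> 0 <= y <= 1 -> g x y = gc x y.
  by move=> x01 y01; rewrite /gc !clamp01_id.
have I (x : R) : 0 <= clamp01 x <= 1 := clamp01_itv x.
have gc_cont : continuous (fun p : R * R => gc p.1 p.2) by exact: continuous_clamp01.
have gc01 x b : 0 <= gc x b <= 1 by exact: g01.
have gc_ndx x x' b : x <= x' -> gc x b <= gc x' b.
  by move=> xx'; apply: g_ndx => //; exact: clamp01_le.
have gc_niy x b b' : b <= b' -> gc x b' <= gc x b.
  by move=> bb'; apply: g_niy => //; exact: clamp01_le.
have clamp1 : clamp01 (1 : R) = 1 by rewrite clamp01_id// ler01 lexx.
have gc_diff x b b' : b <= b' -> gc 1 b' - gc x b' <= gc 1 b - gc x b.
  move=> /clamp01_le; rewrite /gc clamp1 le_eqVlt => /orP[/eqP -> //|bb'].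
  exact: g_diff.
have gc_growth y a b : 0 <= y <= 1 -> 0 <= a -> a <= b -> b <= 1 ->
    gc b y - gc a y <= \int[lebesgue_measure]_(x in `[a, b]) gc x y.
  move=> y01 a0 ab b1; apply: (@deriv_le01_growth R (gc ^~ y) (g ^~ y)) => //.
  - exact: continuous_section1.
  - by move=> x x' xx'; exact: gc_ndx.
  - by move=> x; case/andP: (gc01 x y).
  - by move=> x x01; exact: ggc.
  - exact: g_dx.
have gc_decay x a b : 0 <= x <= 1 -> 0 <= a -> a <= b -> b <= 1 ->
    (1 + a - b) * (1 - gc x b) <= 1 - gc x a.
  move=> x01 a0 ab b1; apply: (@deriv_ge01_decay R (gc x) (g x)) => //.
  - move=> y; apply/cvgrPdist_lt => e e0.
    have /cvgrPdist_lt/(_ e e0)/nbhs_ballP[r /= r0 rV] := @gc_cont (x, y).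
    apply/nbhs_ballP; exists r => //= s ys; apply: (rV (x, s)).
    by split=> //; exact: ballxx.
  - by move=> y y01; exact: ggc.
  - exact: g_dy.
rewrite expectation.unlock (ranking_bound_congr ggc).
rewrite [leRHS](_ : _ =
  (\int[P]_t (matching_weight w (ranking_matching gc E w idV (Y ^~ t)))%:E)%E).
  exact: expected_ranking_weight.
(* All draws lie in [0, 1], where [g] and [gc] agree, so the two matchings coincide. *)
apply: eq_integral => t _; congr (matching_weight _ _)%:E.
have [Y01 _ _] := iidY.
apply: ranking_matching_congr => // u v v'.
by rewrite /preferred /score !ggc.
Qed.
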